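(* There exist universal constants $c,c_1,c_2>0$ and thresholds $\varepsilon_0,\delta_0>0$, $S_0,A_0\in\mathbb N$ such that the following holds. For any $0<\varepsilon\le\varepsilon_0$, any $0<\delta\le\delta_0$, any integers $S\ge S_0$, $A\ge A_0$, any $H\ge\max\{c_1\log_A S,\,c_2\}$, and any algorithm $\mathscr A$ with generative-model access that is $(\varepsilon,\delta)$-correct for communicating average-reward MDPs, there is a communicating MDP with at most $S$ states, at most $A$ actions and optimal bias span $sp(h^* )\le H$ such that, when $\mathscr A$ is run on this MDP, the expected total number of samples it draws over all state-action pairs is at least \[ c\,S\,A\,H\,\varepsilon^{-2}\ln\frac1\delta. \]
   Context: An MDP is a tuple $M=(\mathcal S,\mathcal A,P,r)$ with finite state set $\mathcal S$, finite action set $\mathcal A$, transition probabilities $P(s'\mid s,a)$ and known deterministic reward $r:\mathcal S\times\mathcal A\to[0,1]$. A stationary policy $\pi$ assigns to each state a probability distribution on $\mathcal A$. With $V_T^\pi(s):=\mathbb E^\pi[\sum_{t=0}^{T-1}r(s_t,a_t)\mid s_0=s]$, its gain is $\rho^\pi(s):=\lim_{T\to\infty}\frac1T V_T^\pi(s)$ and its bias is $h^\pi(s):=\mathrm{C}\text{-}\lim_{T\to\infty}[V_T^\pi(s)-T\rho^\pi(s)]$ (Cesàro limit); $\rho^*:=\max_\pi\rho^\pi$. A stationary policy $\pi$ is $\varepsilon$-optimal if $\rho^\pi\ge\rho^*-\varepsilon$ at every state. The optimal bias is $h^*:=h^{\pi^*}$, where $\pi^*$ is a stationary gain-optimal policy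 whose bias satisfies the Bellman optimality equation $\rho^*+h^*(s)=\max_a\{r(s,a)+\sum_{s'}P(s'\mid s,a)h^*(s')\}$ for all $s$; $sp(x):=\max_i x_i-\min_i x_i$. $M$ is communicating if its diameter $\max_{s_1\ne s_2}\min_\pi\mathbb E^\pi_{s_1}[\tau_{s_2}]$ ($\tau_{s_2}$ the hitting time of $s_2$) is finite. A generative model of $M$ returns, on each query $(s,a)$, an independent sample $s'\sim P(\cdot\mid s,a)$. An algorithm knows $\mathcal S,\mathcal A,r$ but not $P$, may query the generative model adaptively and may be randomized, and outputs a stationary policy. It is $(\varepsilon,\delta)$-correct if for every communicating MDP it outputs an $\varepsilon$-optimal stationary policy with probability at least $1-\delta$. *)

(* Defs.v *)
From HB Require Import structures.
From mathcomp Require Export all_boot all_order all_algebra.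
From mathcomp Require Export all_classical all_reals all_analysis.

Set Implicit Arguments.
Unset Strict Implicit.
Unset Printing Implicit Defensive.

Import Order.TTheory GRing.Theory Num.Theory.
Import numFieldNormedType.Exports.

Local Open Scope classical_set_scope.
Local Open Scope ring_scope.

Record fdist (R : realType) (T : finType) := FDist {
  fdist_fun :> T -> R ;
  fdist_ge0 : forall x, 0 <= fdist_fun x ;
  fdist_sum1 : \sum_x fdist_fun x = 1 }.

(* An MDP is split into what a learner knows (states, actions, rewards) and
   the transition kernel.  Both sets are nonempty, as is implicit in the max
   over actions and in the existence of a policy. *)
Record mdp_frame (R : realType) := MDPFrame {
  state : finType ;
  action : finType ;
  state_gt0 : (0 < #|state|)%N ;
  action_gt0 : (0 < #|action|)%N ;
  reward : state -> action -> R ;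
  reward01 : forall s a, 0 <= reward s a <= 1 }.

Record mdp (R : realType) := MDP {
  mdp_known :> mdp_frame R ;
  trans : state mdp_known -> action mdp_known -> fdist R (state mdp_known) }.

Definition policy (R : realType) (F : mdp_frame R) :=
  state F -> fdist R (action F).

(* Expectation of a random variable with values in {0, 1, 2, ...} U {+oo}
   whose finite values have probabilities [p 0], [p 1], ...; the remaining
   mass sits at +oo (recall that [+oo * 0 = 0] in [\bar R]). *)
Definition expect_enat (R : realType) (p : nat -> R) : \bar R :=
  (\sum_(0 <= n <oo) (n%:R * p n)%:E
   + +oo * (1 - \sum_(0 <= n <oo) (p n)%:E))%E.

(* The span seminorm: sup and inf range over finitely many values. *)
Definition span (R : realType) (T : finType) (x : T -> R) : R :=
  sup (range x) - inf (range x).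

Section Dynamics.
Context (R : realType) (M : mdp R).
Implicit Types (pi : policy M) (s : state M).

(* Probability that the process with initial law [nu] starts with the
   state-action pairs listed in [tau]. *)
Fixpoint path_prob pi (nu : state M -> R) (tau : seq (state M * action M)) : R :=
  if tau is (s, a) :: tau' then nu s * pi s a * path_prob pi (trans s a) tau'
  else 1.

Definition path_prob_from pi s (tau : seq (state M * action M)) : R :=
  path_prob pi (fun s' => (s' == s)%:R) tau.

Definition value pi (T : nat) s : R :=
  \sum_(tau : T.-tuple (state M * action M))
     path_prob_from pi s tau * \sum_(x <- tau) reward x.1 x.2.

(* [limn] is total; both limits below exist for every stationary policy of a
   finite MDP. *)
Definition gain pi s : R := limn (fun T => value pi T s / T%:R).

Definition bias pi s : R :=
  limn (arithmetic_mean (fun T => value pi T s - T%:R * gain pi s)).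

Definition opt_gain s : R := sup (range (fun pi => gain pi s)).

Definition eps_optimal (eps : R) pi : Prop :=
  forall s, opt_gain s - eps <= gain pi s.

Definition gain_optimal pi : Prop := forall s, gain pi s = opt_gain s.

Definition bellman_optimality (h : state M -> R) : Prop :=
  forall s, opt_gain s + h s =
    sup (range (fun a => reward s a + \sum_s' trans s a s' * h s')).

(* The policy [pi], hence [h], need not be unique. *)
Definition optimal_bias (h : state M -> R) : Prop :=
  exists pi, [/\ gain_optimal pi, h = bias pi & bellman_optimality h].

Definition hitting_pmf pi s1 s2 (n : nat) : R :=
  \sum_(tau : n.+1.-tuple (state M * action M) | index s2 (unzip1 tau) == n)
     path_prob_from pi s1 tau.

Definition mean_hitting_time pi s1 s2 : \bar R :=
  expect_enat (hitting_pmf pi s1 s2).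

Definition diameter : \bar R :=
  \big[maxe/0%E]_(p : state M * state M | p.1 != p.2)
     ereal_inf (range (fun pi => mean_hitting_time pi p.1 p.2)).

Definition communicating : Prop := (diameter < +oo)%E.

End Dynamics.

(* The history of a run: the queries made so far with the sampled next states,
   most recent first. *)
Definition history (R : realType) (F : mdp_frame R) :=
  seq (state F * action F * state F).

(* A randomized adaptive sampling rule in behavioural form.  Given the history,
   [decide] is the law of the next decision: [Some (s, a)] queries (s, a), and
   [None] stops.  After stopping, the output policy is drawn using a fresh seed
   from an arbitrary probability space. *)
Record sampler (R : realType) (F : mdp_frame R) := Sampler {
  decide : history F -> fdist R (option (state F * action F)) ;
  seed_display : measure_display ;
  seed_space : measurableType seed_display ;
  seed_law : probability seed_space R ;
  output : history F -> seed_space -> policy F ;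
  measurable_output : forall h s a,
    measurable_fun [set: seed_space] (fun w => output h w s a) }.

Arguments output {R F}.

Definition algorithm (R : realType) := forall F : mdp_frame R, sampler F.

Section Interaction.
Context (R : realType) (M : mdp R) (alg : sampler M).

(* Probability that the first [size h] decisions are queries and that they
   produce [h]; conditionally on the past, the sample answering the query
   (s, a) has law [trans s a]. *)
Fixpoint reach_prob (h : history M) : R :=
  if h is (s, a, s') :: h' then
    reach_prob h' * decide alg h' (Some (s, a)) * trans s a s'
  else 1.

Definition stop_prob (h : history M) : R := reach_prob h * decide alg h None.

Definition nb_samples_pmf (n : nat) : R :=
  \sum_(h : n.-tuple (state M * action M * state M)) stop_prob h.

(* A run that never stops draws +oo samples. *)
Definition expected_samples : \bar R := expect_enat nb_samples_pmf.

Definition success_prob (eps : R) : \bar R :=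
  (\sum_(0 <= n <oo) \sum_(h : n.-tuple (state M * action M * state M))
     (stop_prob h)%:E *
     seed_law alg [set w | eps_optimal eps (output alg h w)])%E.

End Interaction.

Definition eps_delta_correct (R : realType) (eps delta : R)
    (alg : algorithm R) : Prop :=
  forall M : mdp R, communicating M ->
    ((1 - delta)%:E <= success_prob (alg M) eps)%E.

(* Main.v *)
(* Take components [j], each made of a rewarding and an idle state that swap at
   rate p = 1/H, so that every component has gain 1/2 and the bias gap is H/2.
   From the idle states, cheap moves along a de Bruijn graph reach every
   component in log_A S steps, which bounds the span of all solutions of the
   optimality equation.  The witness is this symmetric MDP.  Lowering the rate of
   one pair (i, a) to p(1 - 16 eps) forces every eps-optimal policy to play a at i
   with probability more than 1/2, while one sample of (i, a) carries information
   at most 4p(16 eps)^2.  Since at most one action per state has probability more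
   than 1/2, a correct algorithm run on the witness must, for most pairs (i, a),
   gather information of order ln(1/delta) from the samples of (i, a).  The
   alternatives need not have a small bias span, only to be communicating. *)
Require Import Defs.
From mathcomp Require Import measurable_realfun ring lra zify.
Import Order.TTheory GRing.Theory Num.Theory.
Import numFieldNormedType.Exports.
Set Implicit Arguments.
Unset Strict Implicit.
Unset Printing Implicit Defensive.
Local Open Scope classical_set_scope.
Local Open Scope ring_scope.

(** * Finite distributions and path sums *)

Lemma big_tuple0 (V : nmodType) (T : finType) (F : seq T -> V) :
  \sum_(t : 0.-tuple T) F t = F [::].
Proof.
rewrite (bigD1 [tuple]) //= big1 ?addr0 // => t /eqP; by rewrite tuple0.
Qed.

Lemma big_tupleS (V : nmodType) (T : finType) (n : nat) (F : seq T -> V) :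
  \sum_(t : n.+1.-tuple T) F t = \sum_(x : T) \sum_(t : n.-tuple T) F (x :: t).
Proof.
rewrite pair_big /= (reindex (fun p : T * n.-tuple T => [tuple of p.1 :: p.2])) //=.
exists (fun t => (thead t, [tuple of behead t])).
- by move=> [x t] _ /=; rewrite theadE; congr pair; apply: val_inj.
- by move=> t _; apply: val_inj; rewrite /= [in RHS](tuple_eta t).
Qed.

Section Fdist.
Context (R : realType) (T : finType).

Lemma sum_dirac (f : T -> R) x : \sum_y (y == x)%:R * f y = f x.
Proof.
rewrite (bigD1 x) //= eqxx mul1r big1 ?addr0 // => y /negbTE ->.
by rewrite mul0r.
Qed.

Lemma dirac_ge0 (x y : T) : 0 <= (y == x)%:R :> R.
Proof. exact: ler0n. Qed.

Lemma dirac_sum1 (x : T) : \sum_y (y == x)%:R = 1 :> R.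
Proof. by rewrite -[RHS](sum_dirac (fun=> 1) x); apply: eq_bigr => y _; rewrite mulr1. Qed.

Definition dirac_fdist (x : T) : fdist R T := FDist (dirac_ge0 x) (dirac_sum1 x).

Lemma fdist_sum_le (d : fdist R T) (f g : T -> R) :
  (forall x, f x <= g x) -> \sum_x d x * f x <= \sum_x d x * g x.
Proof. by move=> fg; apply: ler_sum => x _; rewrite ler_wpM2l // fdist_ge0. Qed.

Lemma fdist_sum_cst (d : fdist R T) (c : R) : \sum_x d x * c = c.
Proof. by rewrite -mulr_suml fdist_sum1 mul1r. Qed.

Lemma fdist_sumDcst (d : fdist R T) (c : R) (f : T -> R) :
  \sum_x d x * (c + f x) = c + \sum_x d x * f x.
Proof.
under eq_bigr do rewrite mulrDr.
by rewrite big_split /= fdist_sum_cst.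
Qed.

End Fdist.

Section Paths.
Context (R : realType) (M : mdp R).
Implicit Types (pi : policy M) (s : state M).

(** The initial law enters linearly, except on the empty path, where its total mass 1 is used. *)
Lemma path_prob_mix pi (nu : fdist R (state M)) tau :
  path_prob pi nu tau = \sum_s nu s * path_prob_from pi s tau.
Proof.
case: tau => [|[s a] tau]; first by rewrite fdist_sum_cst.
rewrite /path_prob_from /= -(sum_dirac (fun t => nu t * pi s a * path_prob pi (trans s a) tau) s).
by apply: eq_bigr => t _; rewrite [s == t]eq_sym !mulrA [_ * nu t]mulrC.
Qed.

(** First-step decomposition for an arbitrary path functional [F]; the recursions for values and for
    hitting probabilities are its instances. *)
Lemma path_sumS pi s n (F : seq (state M * action M) -> R) :
  \sum_(tau : n.+1.-tuple (state M * action M)) path_prob_from pi s tau * F tau =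
  \sum_a pi s a * \sum_s' trans s a s' *
    \sum_(tau : n.-tuple (state M * action M)) path_prob_from pi s' tau * F ((s, a) :: tau).
Proof.
rewrite (big_tupleS _ (fun tau => path_prob_from pi s tau * F tau)).
transitivity (\sum_t \sum_a \sum_(tau : n.-tuple (state M * action M))
    path_prob_from pi s ((t, a) :: tau) * F ((t, a) :: tau)).
  by rewrite [RHS]pair_bigA; apply: eq_bigr => -[].
rewrite (bigD1 s) //= [X in _ + X]big1 ?addr0; last first.
  move=> t /negbTE ts; apply: big1 => a _; apply: big1 => tau _.
  by rewrite /path_prob_from /= ts !mul0r.
apply: eq_bigr => a _.
under [in RHS]eq_bigr do rewrite mulr_sumr.
rewrite exchange_big /= mulr_sumr; apply: eq_bigr => tau _.
rewrite {1}/path_prob_from /= eqxx mul1r path_prob_mix -mulrA mulr_suml.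
by congr (_ * _); apply: eq_bigr => t _; rewrite mulrA.
Qed.

Lemma path_sum1 pi s n :
  \sum_(tau : n.-tuple (state M * action M)) path_prob_from pi s tau = 1.
Proof.
elim: n s => [|n IH] s; first by rewrite (big_tuple0 (path_prob_from pi s)).
under eq_bigr do rewrite -[path_prob_from _ _ _]mulr1.
rewrite (path_sumS pi s n (fun=> 1)) -[RHS](fdist_sum1 (pi s)).
apply: eq_bigr => a _; rewrite -[RHS]mulr1; congr (_ * _).
rewrite -[RHS](fdist_sum1 (trans s a)); apply: eq_bigr => t _.
by rewrite -[RHS]mulr1 -[in RHS](IH t); under eq_bigr do rewrite mulr1.
Qed.

Lemma value0 pi s : value pi 0 s = 0.
Proof.
rewrite /value.
rewrite (big_tuple0 (fun tau => path_prob_from pi s tau * \sum_(x <- tau) reward x.1 x.2)).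
by rewrite big_nil mulr0.
Qed.

Lemma valueS pi n s :
  value pi n.+1 s = \sum_a pi s a * (reward s a + \sum_s' trans s a s' * value pi n s').
Proof.
rewrite {1}/value (path_sumS pi s n (fun tau => \sum_(x <- tau) reward x.1 x.2)).
apply: eq_bigr => a _; congr (_ * _).
rewrite -(fdist_sumDcst (trans s a)); apply: eq_bigr => t _; congr (_ * _).
under eq_bigr do rewrite big_cons mulrDr.
by rewrite big_split /= -mulr_suml path_sum1 mul1r.
Qed.

(* Non-convergent averages have [limn] equal to [0]. *)
Lemma gain_le pi s (g C : R) : 0 <= g ->
  (forall n, value pi n s <= n%:R * g + C) -> gain pi s <= g.
Proof.
move=> g0 bnd; rewrite /gain.
have [cv|/dvgP -> //] := pselect (cvgn (fun n => value pi n s / n%:R)).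
have h : (fun n => g + C * n%:R^-1) @ \oo --> g + C * 0.
  apply: cvgD; first exact: cvg_cst.
  apply: cvgMr; apply/gtr0_cvgV0; last exact: cvgr_idn.
  by near=> n; rewrite ltr0n; near: n; exists 1%N.
rewrite mulr0 addr0 in h; rewrite -[leRHS](cvg_lim _ h) //.
apply: ler_lim => //; first by apply/cvg_ex; exists g.
near=> n.
have n0 : 0 < n%:R :> R by rewrite ltr0n; near: n; exists 1%N.
rewrite ler_pdivrMr // mulrDl -mulrA mulVf ?mulr1 ?gt_eqF //.
by rewrite [g * _]mulrC.
Unshelve. all: by end_near. Qed.

(** A supersolution [h] of the evaluation equation dominates the values by induction on the horizon;
    the constant [C] absorbs its negative part. *)
Lemma gain_upper pi (g : R) (h : state M -> R) : 0 <= g ->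
  (forall s, \sum_a pi s a * (reward s a + \sum_s' trans s a s' * h s') <= g + h s) ->
  forall s, gain pi s <= g.
Proof.
move=> g0 hB s.
pose C := \sum_s `|h s|.
have hC t : - h t <= C.
  rewrite /C (bigD1 t) //= (le_trans (ler_norm _)) // normrN lerDl.
  by apply: sumr_ge0 => u _.
suff bnd n t : value pi n t <= n%:R * g + (h t + C).
  by apply: (@gain_le _ _ _ (h s + C)).
elim: n t => [|n IH] t; first by rewrite value0 mul0r add0r -lerBlDl sub0r.
rewrite valueS.
apply: (@le_trans _ _ (\sum_a pi t a * ((n%:R * g + C) + (reward t a + \sum_s' trans t a s' * h s')))).
  apply: fdist_sum_le => a.
  rewrite addrCA lerD2l -fdist_sumDcst; apply: fdist_sum_le => u.
  by rewrite (le_trans (IH u)) // addrAC addrA.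
rewrite fdist_sumDcst -natr1 mulrDl mul1r.
by have := hB t; lra.
Qed.

End Paths.

(** * Expectations on the extended naturals and hitting times *)

Section ExpectEnat.
Context (R : realType).
Implicit Types p : nat -> R.

Definition psum p (N : nat) : R := \sum_(0 <= n < N) p n.

(* [E[min(X, N)]] for [X] with finite values distributed according to [p]. *)
Definition tmean p (N : nat) : R :=
  psum (fun n => n%:R * p n) N + N%:R * (1 - psum p N).

Lemma psum_ge0 p N : (forall n, 0 <= p n) -> 0 <= psum p N.
Proof. by move=> p0; apply: sumr_ge0. Qed.

Lemma psum_mono p m n : (forall n, 0 <= p n) -> (m <= n)%N -> psum p m <= psum p n.
Proof.
move=> p0 mn; rewrite /psum (big_cat_nat (n := m) (p := n)) //= lerDl.
exact: sumr_ge0.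
Qed.

Lemma psumS p N : psum p N.+1 = p 0%N + psum (fun n => p n.+1) N.
Proof. by rewrite /psum big_nat_recl. Qed.

Lemma psum_le_series p N : (forall n, 0 <= p n) ->
  ((psum p N)%:E <= \sum_(0 <= n <oo) (p n)%:E)%E.
Proof.
move=> p0; rewrite -sumEFin.
by apply: (nneseries_lim_ge N) => n _ _; rewrite lee_fin.
Qed.

Lemma series_le p (b : \bar R) : (forall n, 0 <= p n) ->
  (forall N, ((psum p N)%:E <= b)%E) -> (\sum_(0 <= n <oo) (p n)%:E <= b)%E.
Proof.
move=> p0 pb; apply: lime_le.
  by apply: is_cvg_nneseries => n _ _; rewrite lee_fin.
by apply: nearW => N; rewrite sumEFin; apply: pb.
Qed.

Context (p : nat -> R).
Hypothesis p_ge0 : forall n, 0 <= p n.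
Hypothesis p_le1 : forall N, psum p N <= 1.

Let np_ge0 n : 0 <= n%:R * p n.
Proof. by rewrite mulr_ge0. Qed.

Let total_fin : exists2 s : R, s <= 1 & (\sum_(0 <= n <oo) (p n)%:E)%E = s%:E.
Proof.
have le1 : (\sum_(0 <= n <oo) (p n)%:E <= 1%:E)%E.
  by apply: series_le => // N; rewrite lee_fin.
have ge0 : (0 <= \sum_(0 <= n <oo) (p n)%:E)%E.
  by apply: nneseries_ge0 => n _ _; rewrite lee_fin.
move: le1 ge0; case: (\sum_(0 <= n <oo) _)%E => // s s1 _.
by exists s.
Qed.

Let mean_ge0 : (0 <= \sum_(0 <= n <oo) (n%:R * p n)%:E)%E.
Proof. by apply: nneseries_ge0 => n _ _; rewrite lee_fin. Qed.

Lemma expect_enat_defect (b : R) : b < 1 -> (forall N, psum p N <= b) ->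
  expect_enat p = +oo%E.
Proof.
move=> b1 pb; have [s s1 Es] := total_fin; rewrite /expect_enat Es.
have sb : s <= b by rewrite -lee_fin -Es; apply: series_le => // N; rewrite lee_fin.
rewrite gt0_mulye; last by rewrite -EFinB lte_fin subr_gt0 (le_lt_trans sb).
by rewrite addey //; move: mean_ge0; case: (\sum_(0 <= n <oo) _)%E.
Qed.

Lemma expect_enat_total : (forall e : R, 0 < e -> exists N, 1 - e <= psum p N) ->
  expect_enat p = (\sum_(0 <= n <oo) (n%:R * p n)%:E)%E.
Proof.
move=> pe; have [s s1 Es] := total_fin; rewrite /expect_enat Es.
suff -> : s = 1 by rewrite -EFinB subrr mule0 adde0.
apply/eqP; rewrite eq_le s1 /=; apply/ler_addgt0Pl; move=> e; move: (e : R) => {}e e0.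
have [N] := pe e e0; rewrite lerBlDl => /le_trans; apply; rewrite lerD2l.
by rewrite -lee_fin -Es; apply: psum_le_series.
Qed.

(** Partial masses bounded away from 1 leave positive weight on +oo, which makes the mean
    infinite. *)
Lemma expect_enat_dich :
  (forall e : R, 0 < e -> exists N, 1 - e <= psum p N) \/ expect_enat p = +oo%E.
Proof.
have [|/existsNP[e /not_implyP[e0 /forallNP he]]] :=
  pselect (forall e : R, 0 < e -> exists N, 1 - e <= psum p N); first by left.
right; apply: (@expect_enat_defect (1 - e)); first by rewrite ltrBlDr ltrDl.
by move=> N; have /negP := he N; rewrite -ltNge => /ltW.
Qed.

Lemma tmean_le_expect N : ((tmean p N)%:E <= expect_enat p)%E.
Proof.
have [pe|-> ] := expect_enat_dich; last by rewrite leey.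
rewrite expect_enat_total //.
case E : (\sum_(0 <= n <oo) (n%:R * p n)%:E)%E => [r| |]; last 2 first.
- by rewrite leey.
- by move: mean_ge0; rewrite E.
rewrite lee_fin; apply/ler_addgt0Pl; move=> e; move: (e : R) => {}e e0.
(* The mass missing at the later level [L'] has weight [N] in [tmean p N], so [d] makes it cost at
   most [e]. The denominator [N.+1] covers [N = 0]. *)
have [d d0 hd] : exists2 d : R, 0 < d & N%:R * d <= e.
  exists (e / N.+1%:R); first exact: divr_gt0.
  rewrite mulrCA -[leRHS]mulr1 ler_wpM2l ?(ltW e0) // ler_pdivrMr // mul1r.
  by rewrite ler_nat.
have [L hL] := pe _ d0.
pose L' := maxn L N.
have hL' : 1 - d <= psum p L'.
  by rewrite (le_trans hL) // psum_mono // leq_maxl.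
have h : psum (fun n => n%:R * p n) L' <= r.
  by rewrite -lee_fin -E; apply: (psum_le_series (p := fun n => n%:R * p n)).
have NL' : (N <= L')%N by rewrite leq_maxr.
have split q : psum q L' = psum q N + \sum_(N <= n < L') q n.
  by rewrite /psum (big_cat_nat (n := N)).
have tl : N%:R * \sum_(N <= n < L') p n <= \sum_(N <= n < L') n%:R * p n.
  rewrite mulr_sumr; apply: ler_sum_nat => n /andP[Nn _].
  by rewrite ler_wpM2r // ler_nat.
have hN : N%:R * (1 - psum p L') <= N%:R * d.
  by rewrite ler_wpM2l // lerBlDl -lerBlDr.
rewrite !split in h hN; rewrite /tmean; move: h hN hd tl.
rewrite !mulrBr !mulr1 !mulrDr; lra.
Qed.

Lemma expect_enat_fin (V : R) : (forall N, tmean p N <= V) -> (expect_enat p < +oo)%E.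
Proof.
move=> hV.
have rest N : 0 <= N%:R * (1 - psum p N) by rewrite mulr_ge0 // subr_ge0.
have sum0 N : 0 <= psum (fun n => n%:R * p n) N by exact: psum_ge0.
have V0 : 0 <= V by rewrite (le_trans _ (hV 0%N)) // addr_ge0.
have pe e : 0 < e -> exists N, 1 - e <= psum p N.
  (* Markov's inequality: the mass missing at level [N] is at most [V / N]. *)
  move=> e0; exists (Num.Def.archi_bound (V / e)).
  have := archi_boundP (divr_ge0 V0 (ltW e0)).
  set N := Num.Def.archi_bound _; rewrite ltr_pdivrMr // => VN.
  have := hV N; have := sum0 N; rewrite /tmean => h1 h2.
  have N0 : 0 < N%:R :> R.
    by rewrite -(pmulr_lgt0 _ e0) (le_lt_trans V0).
  have : N%:R * (1 - psum p N) <= N%:R * e by lra.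
  by rewrite ler_pM2l //; lra.
rewrite expect_enat_total //; apply: le_lt_trans (ltry V).
apply: series_le => // N; rewrite lee_fin.
by have := hV N; have := rest N; rewrite /tmean; lra.
Qed.

End ExpectEnat.

Section HittingTime.
Context (R : realType) (M : mdp R) (pi : policy M) (t : state M).

Lemma hitting_pmfS s n : s != t ->
  hitting_pmf pi s t n.+1 =
    \sum_a pi s a * \sum_s' trans s a s' * hitting_pmf pi s' t n.
Proof.
move=> st; rewrite /hitting_pmf big_mkcond /=.
under eq_bigr do rewrite -mulrb -[_ *+ _]mulr_natr.
rewrite (path_sumS pi s _ (fun tau => (index t (unzip1 tau) == n.+1)%:R)) /=.
apply: eq_bigr => a _; congr (_ * _); apply: eq_bigr => s' _; congr (_ * _).
rewrite [RHS]big_mkcond /=; apply: eq_bigr => tau _.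
by rewrite (negbTE st) eqSS mulr_natr mulrb.
Qed.

Lemma hitting_pmf0 s : hitting_pmf pi s t 0 = (s == t)%:R.
Proof.
rewrite /hitting_pmf big_mkcond /=.
under eq_bigr do rewrite -mulrb -[_ *+ _]mulr_natr.
rewrite (path_sumS pi s _ (fun tau => (index t (unzip1 tau) == 0)%:R)) /=.
transitivity (\sum_a pi s a * \sum_s' trans s a s' * (s == t)%:R).
  apply: eq_bigr => a _; congr (_ * _); apply: eq_bigr => s' _; congr (_ * _).
  rewrite -[RHS]mul1r -(path_sum1 pi s' 0) mulr_suml.
  by apply: eq_bigr => tau _; case: (s == t).
by under eq_bigr do rewrite fdist_sum_cst; rewrite fdist_sum_cst.
Qed.

Lemma hitting_pmf_target n : hitting_pmf pi t t n.+1 = 0.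
Proof.
rewrite /hitting_pmf big1 // => tau.
case: (tupleP tau) => -[s a] tau' /=; rewrite /path_prob_from /=.
by have [->|_ _] := eqVneq s t; rewrite ?mul0r.
Qed.

Lemma path_prob_ge0 (nu : state M -> R) tau :
  (forall s, 0 <= nu s) -> 0 <= path_prob pi nu tau.
Proof.
elim: tau nu => [|[u a] tau IH] nu nu0 //=.
by rewrite !mulr_ge0 ?fdist_ge0 // IH // => s'; apply: fdist_ge0.
Qed.

Lemma hitting_pmf_ge0 s n : 0 <= hitting_pmf pi s t n.
Proof. by apply: sumr_ge0 => tau _; apply: path_prob_ge0. Qed.

(** The weight [w] serves twice: as 1 for masses and as [n.+1] for means. *)
Lemma psum_hittingS s N (w : nat -> R) : s != t ->
  psum (fun n => w n * hitting_pmf pi s t n.+1) N =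
    \sum_a pi s a * \sum_s' trans s a s' *
      psum (fun n => w n * hitting_pmf pi s' t n) N.
Proof.
move=> st; rewrite /psum.
under eq_bigr do rewrite hitting_pmfS // mulr_sumr.
rewrite exchange_big /=; apply: eq_bigr => a _.
under [in RHS]eq_bigr do rewrite mulr_sumr.
rewrite [in RHS]exchange_big /= mulr_sumr; apply: eq_bigr => n _.
rewrite mulrCA; congr (_ * _); rewrite mulr_sumr; apply: eq_bigr => s' _.
by rewrite mulrCA.
Qed.

Lemma hitting_psum_le1 s N : psum (hitting_pmf pi s t) N <= 1.
Proof.
elim: N s => [|N IH] s; first by rewrite /psum big_geq.
rewrite psumS hitting_pmf0; have [->|st] := eqVneq.
  rewrite /psum (eq_bigr (fun=> 0)) ?big1_eq ?addr0 // => n _.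
  exact: hitting_pmf_target.
rewrite add0r.
have := psum_hittingS N (fun=> 1) st; rewrite /psum.
under eq_bigr do rewrite mul1r.
move=> ->; rewrite -[leRHS](fdist_sum_cst (pi s)); apply: fdist_sum_le => a.
rewrite -[leRHS](fdist_sum_cst (trans s a)); apply: fdist_sum_le => s'.
by under eq_bigr do rewrite mul1r; apply: IH.
Qed.

(** Lyapunov criterion: off the target [V] falls by at least 1 per step on average, so by induction
    on [N] it dominates all truncated means. *)
Lemma mean_hitting_time_fin (V : state M -> R) :
  (forall s, 0 <= V s) ->
  (forall s, s != t -> 1 + \sum_a pi s a * \sum_s' trans s a s' * V s' <= V s) ->
  forall s, (mean_hitting_time pi s t < +oo)%E.
Proof.
move=> V0 hV s0.
suff tV N s : tmean (hitting_pmf pi s t) N <= V s.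
  by apply: (@expect_enat_fin _ _ _ _ (V s0)) => // n;
    [apply: hitting_pmf_ge0 | apply: hitting_psum_le1].
elim: N s => [|N IH] s; first by rewrite /tmean /psum big_geq // mul0r addr0.
have [->|st] := eqVneq s t.
  rewrite /tmean !psumS hitting_pmf0 eqxx mul0r add0r.
  rewrite /psum !big1 ?addr0 ?subrr ?mulr0 ?addr0 // => n _.
    exact: hitting_pmf_target.
  by rewrite hitting_pmf_target mulr0.
apply: le_trans (hV s st).
rewrite /tmean !psumS hitting_pmf0 (negbTE st) mulr0 !add0r.
have e1 : psum (fun n => hitting_pmf pi s t n.+1) N =
    \sum_a pi s a * \sum_s' trans s a s' * psum (hitting_pmf pi s' t) N.
  have := psum_hittingS N (fun=> 1) st; rewrite /psum.
  under eq_bigr do rewrite mul1r.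
  move=> ->; apply: eq_bigr => a _; congr (_ * _); apply: eq_bigr => s' _.
  by under eq_bigr do rewrite mul1r.
have e2 := psum_hittingS N (fun n => n.+1%:R) st.
rewrite e1 e2.
have -> : N.+1%:R * (1 - \sum_a pi s a * \sum_s' trans s a s' * psum (hitting_pmf pi s' t) N)
  = \sum_a pi s a * \sum_s' trans s a s' * (N.+1%:R * (1 - psum (hitting_pmf pi s' t) N)).
  transitivity (\sum_a pi s a * \sum_s' trans s a s' * (N.+1%:R + (- N.+1%:R) * psum (hitting_pmf pi s' t) N)).
    under [RHS]eq_bigr do rewrite fdist_sumDcst; rewrite fdist_sumDcst.
    rewrite mulrBr mulr1 -mulNr mulr_sumr; congr (_ + _); apply: eq_bigr => a _.
    rewrite mulrCA; congr (_ * _); rewrite mulr_sumr; apply: eq_bigr => s' _.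
    by rewrite mulrCA.
  apply: eq_bigr => a _; congr (_ * _); apply: eq_bigr => s' _; congr (_ * _).
  by rewrite mulrBr mulr1 mulNr.
rewrite -big_split /= -fdist_sumDcst.
apply: ler_sum => a _; rewrite -mulrDr ler_wpM2l ?fdist_ge0 //.
rewrite -big_split -(fdist_sumDcst _ 1) /=; apply: ler_sum => s' _.
rewrite -mulrDr ler_wpM2l ?fdist_ge0 //.
have := IH s'; rewrite /tmean.
(* The shifted sum and the level [N.+1] together give exactly 1 plus [tmean] at level [N]. *)
have -> : psum (fun n => n.+1%:R * hitting_pmf pi s' t n) N =
    psum (fun n => n%:R * hitting_pmf pi s' t n) N + psum (hitting_pmf pi s' t) N.
  rewrite /psum -big_split; apply: eq_bigr => n _ /=.
  by rewrite -natr1 mulrDl mul1r.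
rewrite -natr1; lra.
Qed.

End HittingTime.

Lemma communicatingP (R : realType) (M : mdp R) (pi : policy M) :
  (forall s t : state M, (mean_hitting_time pi s t < +oo)%E) -> communicating M.
Proof.
move=> h; rewrite /communicating /diameter.
elim/big_ind: _ => [|x y x1 y1|[s t] _]; first exact: ltry.
  by rewrite gt_max x1.
by apply: le_lt_trans (h s t); apply: ereal_inf_lbound; exists pi.
Qed.

(** * The hard family *)

Section FdistMix.
Context (R : realType) (T : finType) (w : R) (w01 : 0 <= w <= 1).
Context (d e : fdist R T).

Lemma mix_ge0 x : 0 <= w * d x + (1 - w) * e x.
Proof.
have /andP[w0 w1] := w01.
by rewrite addr_ge0 // mulr_ge0 ?fdist_ge0 // subr_ge0.
Qed.

Lemma mix_sum1 : \sum_x (w * d x + (1 - w) * e x) = 1.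
Proof. by rewrite big_split /= -!mulr_sumr !fdist_sum1 !mulr1 addrC subrK. Qed.

Definition mix_fdist : fdist R T := FDist mix_ge0 mix_sum1.

Lemma mix_sum (f : T -> R) :
  \sum_x mix_fdist x * f x = w * (\sum_x d x * f x) + (1 - w) * (\sum_x e x * f x).
Proof.
rewrite !mulr_sumr -big_split /=; apply: eq_bigr => x _.
by rewrite mulrDl !mulrA.
Qed.

End FdistMix.

Section FdistUniform.
Context (R : realType) (T : finType) (T0 : (0 < #|T|)%N).

Lemma uniform_ge0 (x : T) : 0 <= #|T|%:R^-1 :> R.
Proof. by rewrite invr_ge0. Qed.

Lemma uniform_sum1 : \sum_(x : T) #|T|%:R^-1 = 1 :> R.
Proof. by rewrite sumr_const -[_ *+ _]mulr_natr mulVf // pnatr_eq0 -lt0n. Qed.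

Definition uniform_fdist : fdist R T := FDist uniform_ge0 uniform_sum1.

Lemma uniform_sum (f : T -> R) :
  \sum_x uniform_fdist x * f x = #|T|%:R^-1 * \sum_x f x.
Proof. by rewrite mulr_sumr. Qed.

End FdistUniform.

Lemma big_option (V : nmodType) (T : finType) (F : option T -> V) :
  \sum_a F a = F None + \sum_(a : T) F (Some a).
Proof.
rewrite (bigD1 None) //=; congr (_ + _).
rewrite (reindex_omap Some id) /=; last by case.
by apply: eq_bigl => a; rewrite eqxx.
Qed.

Section OptimalGain.
Context (R : realType) (M : mdp R).
Implicit Types (pi : policy M) (s : state M).

Lemma gain_le1 pi s : gain pi s <= 1.
Proof.
apply: (@gain_upper _ _ _ _ (fun=> 0)) => // t.
rewrite addr0 -[leRHS](fdist_sum_cst (pi t)); apply: fdist_sum_le => a.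
rewrite big1 ?addr0; last by move=> u _; rewrite mulr0.
by have /andP[] := reward01 t a.
Qed.

Lemma gain_le_opt pi s : gain pi s <= opt_gain s.
Proof.
apply: ub_le_sup; last by exists pi.
by exists 1 => _ [pi' _ <-]; apply: gain_le1.
Qed.

Lemma opt_gain_eq pi s : (forall pi', gain pi' s <= gain pi s) -> opt_gain s = gain pi s.
Proof.
move=> h; apply/eqP; rewrite eq_le gain_le_opt andbT.
by apply: ge_sup; [exists (gain pi s); exists pi | move=> _ [pi' _ <-]].
Qed.

End OptimalGain.

(** The option [a] is read as a boolean: [None] earns nothing, even at a rewarding state. *)
Definition hard_reward (R : realType) (K n : nat) (s : 'I_K * bool) (a : option 'I_n) : R :=
  (s.2 && a)%:R.

Lemma hard_reward01 (R : realType) (K n : nat) (s : 'I_K * bool) (a : option 'I_n) :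
  0 <= hard_reward R s a <= 1.
Proof. by rewrite /hard_reward ler0n lern1 leq_b1. Qed.

Lemma hard_state_gt0 k : (0 < #|{: 'I_k.+1 * bool}|)%N.
Proof. by rewrite card_prod card_ord card_bool. Qed.

Lemma hard_action_gt0 n : (0 < #|{: option 'I_n}|)%N.
Proof. by rewrite card_option. Qed.

Definition hard_frame (R : realType) (k n : nat) : mdp_frame R :=
  MDPFrame (hard_state_gt0 k) (hard_action_gt0 n) (@hard_reward01 R k.+1 n).

Section HardMDP.
Context (R : realType) (k n : nat) (p : R) (q : 'I_k.+1 -> 'I_n -> R).
Hypotheses (p01 : 0 <= p <= 1) (q01 : forall j a, 0 <= q j a <= 1).

(** Appends the base-[n] digit [a] to [j], reduced modulo [k.+1]. *)
Definition nav (j : 'I_k.+1) (a : 'I_n) : 'I_k.+1 := inZp (n * j + a).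

(* [(j, true)] pays reward 1 under every [Some a] and decays to [(j, false)] at
   rate [q j a]; from [(j, false)], [None] goes back up at rate [p], while the
   other actions are the arcs of a de Bruijn graph on the components [j].  The
   slow uniform reset [None] at [(j, true)] makes the MDP communicating. *)
Definition hard_trans (s : state (hard_frame R k n)) (a : action (hard_frame R k n)) :
    fdist R (state (hard_frame R k n)) :=
  match s, a with
  | (j, true), Some a => mix_fdist (q01 j a) (dirac_fdist R (j, false)) (dirac_fdist R (j, true))
  | (j, true), None => mix_fdist p01 (uniform_fdist R (hard_state_gt0 k)) (dirac_fdist R (j, true))
  | (j, false), Some a => dirac_fdist R (nav j a, false)
  | (j, false), None => mix_fdist p01 (dirac_fdist R (j, true)) (dirac_fdist R (j, false))
  end.

Definition hard_mdp : mdp R := @MDP R (hard_frame R k n) hard_trans.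

Lemma hard_up j (a : 'I_n) (f : state hard_mdp -> R) :
  \sum_s' trans (m := hard_mdp) (j, true) (Some a) s' * f s' =
    q j a * f (j, false) + (1 - q j a) * f (j, true).
Proof. by rewrite mix_sum !sum_dirac. Qed.

Lemma hard_reset j (f : state hard_mdp -> R) :
  \sum_s' trans (m := hard_mdp) (j, true) None s' * f s' =
    p * (#|{: 'I_k.+1 * bool}|%:R^-1 * \sum_s' f s') + (1 - p) * f (j, true).
Proof. by rewrite mix_sum uniform_sum sum_dirac. Qed.

Lemma hard_down j (f : state hard_mdp -> R) :
  \sum_s' trans (m := hard_mdp) (j, false) None s' * f s' =
    p * f (j, true) + (1 - p) * f (j, false).
Proof. by rewrite mix_sum !sum_dirac. Qed.

Lemma hard_nav j (a : 'I_n) (f : state hard_mdp -> R) :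
  \sum_s' trans (m := hard_mdp) (j, false) (Some a) s' * f s' = f (nav j a, false).
Proof. by rewrite sum_dirac. Qed.

Definition hardE := (hard_up, hard_reset, hard_down, hard_nav).

Hypothesis p_gt0 : 0 < p.

(** Always playing [None] climbs from idle states and resets uniformly from rewarding ones, so every
    state is reached in finite mean time, for all rates [q]. *)
Lemma hard_communicating : communicating hard_mdp.
Proof.
pose pi : policy hard_mdp := fun=> dirac_fdist R None.
apply: (@communicatingP _ _ pi) => s t; move: s.
pose N : R := #|{: 'I_k.+1 * bool}|%:R.
have N1 : 1 <= N by rewrite ler1n hard_state_gt0.
have N0 : 0 < N by rewrite (lt_le_trans ltr01).
(* Idle states pay an extra [1 / p], the mean time of a climb. A uniform reset hits the target with
   probability [1 / N], so the mean of [V] after it is at most [(N - 1) * (2 * N + 1) / (N * p)],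
   below [(2 * N - 1) / p]. *)
pose W (b : bool) := if b then 2 * N / p else (2 * N + 1) / p.
have W0 b : 0 <= W b by rewrite /W; case: b; rewrite divr_ge0 ?ltW //; nra.
have WE b : W b = (2 * N + (~~ b)%:R) / p by case: b; rewrite /W /= ?addr0.
pose V (s : state hard_mdp) := (s != t)%:R * W s.2.
have VW s : V s <= W s.2.
  by rewrite /V -[leRHS]mul1r ler_wpM2r // lern1 leq_b1.
apply: (@mean_hitting_time_fin _ _ _ _ V) => [s|[j b] st].
  by rewrite /V mulr_ge0.
rewrite sum_dirac {2}/V st mul1r /=.
have cancel_p x : p * (x / p) = x by rewrite mulrCA divff ?mulr1 ?gt_eqF.
case: b st => st; rewrite hardE; last first.
  have h1 : p * V (j, true) <= 2 * N.
    by rewrite -(cancel_p (2 * N)) ler_wpM2l ?(ltW p_gt0) // (le_trans (VW _)).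
  have h2 : (1 - p) * V (j, false) <= (1 - p) * W false.
    by rewrite ler_wpM2l ?(VW (j, false)) // subr_ge0; case/andP: p01.
  have := cancel_p (2 * N + 1); rewrite -/(W false) => h3.
  have h4 : (1 - p) * W false = W false - (2 * N + 1) by rewrite mulrBl mul1r h3.
  by rewrite h4 in h2; lra.
have h2 : (1 - p) * V (j, true) <= (1 - p) * W true.
  by rewrite ler_wpM2l ?(VW (j, true)) // subr_ge0; case/andP: p01.
have h3 : p * W true = 2 * N by exact: cancel_p.
have h4 : \sum_s V s <= (N - 1) * W false.
  apply: (@le_trans _ _ (\sum_s (W false - (s == t)%:R * W false))).
    apply: ler_sum => s _; rewrite /V; case: (s == t) => /=.
      by rewrite mul0r mul1r subrr.
    rewrite mul1r mul0r subr0 !WE ler_wpM2r ?invr_ge0 ?(ltW p_gt0) //.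
    by rewrite lerD2l lern1 leq_b1.
  have d1 : \sum_(s : state hard_mdp) (s == t)%:R * W false = W false.
    exact: (sum_dirac (fun=> W false)).
  rewrite sumrB d1 sumr_const -[_ *+ #|_|]mulr_natl.
  by rewrite [leRHS]mulrBl mul1r.
have h5 : p * (N^-1 * \sum_s V s) <= 2 * N - 1.
  apply: (@le_trans _ _ (p * (N^-1 * ((N - 1) * W false)))).
    by rewrite ler_wpM2l ?(ltW p_gt0) // ler_wpM2l // invr_ge0 ltW.
  have -> : p * (N^-1 * ((N - 1) * W false)) = N^-1 * ((N - 1) * (p * W false)) by ring.
  rewrite cancel_p -ler_pdivlMl ?invr_gt0 // invrK; nra.
have h6 : (1 - p) * W true = W true - 2 * N by rewrite mulrBl mul1r h3.
by rewrite h6 in h2; rewrite -/N; lra.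
Qed.

(* The linear system says that [g] and [bx, by] are the gain and the bias of
   the two-state chain on the component, with second eigenvalue [l]. *)
Lemma hard_value (a : 'I_n) (j : 'I_k.+1) (g bx by_ l : R) :
  let pi : policy hard_mdp := fun s => dirac_fdist R (if s.2 then Some a else None) in
  1 + q j a * (by_ - bx) = g -> p * (bx - by_) = g ->
  q j a * (by_ - bx) = (l - 1) * bx -> p * (bx - by_) = (l - 1) * by_ ->
  forall (b : bool) T, value pi T (j, b) = T%:R * g + (if b then bx else by_) * (1 - l ^+ T).
Proof.
move=> pi e1 e2 e3 e4 b T; elim: T b => [|T IH] b.
  by rewrite value0 mul0r expr0 subrr mulr0 add0r.
rewrite valueS sum_dirac; case: b => /=; rewrite hardE !IH /reward /= /hard_reward /=.
- rewrite exprS.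
  have -> : q j a * (T%:R * g + by_ * (1 - l ^+ T)) + (1 - q j a) * (T%:R * g + bx * (1 - l ^+ T))
   = T%:R * g + bx * (1 - l ^+ T) + (q j a * (by_ - bx)) * (1 - l ^+ T) by ring.
  have -> : T.+1%:R * g = T%:R * g + (1 + q j a * (by_ - bx)).
    by rewrite e1 -natr1 mulrDl mul1r.
  rewrite e3; ring.
- rewrite exprS.
  have -> : p * (T%:R * g + bx * (1 - l ^+ T)) + (1 - p) * (T%:R * g + by_ * (1 - l ^+ T))
   = T%:R * g + by_ * (1 - l ^+ T) + (p * (bx - by_)) * (1 - l ^+ T) by ring.
  have -> : T.+1%:R * g = T%:R * g + p * (bx - by_).
    by rewrite e2 -natr1 mulrDl mul1r.
  rewrite e4; ring.
Qed.

End HardMDP.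

(** * Gain and bias *)

(** The linear part gives the gain; the geometric transient vanishes and leaves [c]. A Cesaro limit
    agrees with an existing ordinary limit. *)
Lemma gain_bias_of_value (R : realType) (M : mdp R) (pi : policy M) (s : state M)
    (g c l : R) : `|l| < 1 ->
  (forall T, value pi T s = T%:R * g + c * (1 - l ^+ T)) ->
  gain pi s = g /\ bias pi s = c.
Proof.
move=> l1 hv.
have cc : (fun T => c * (1 - l ^+ T)) @ \oo --> c.
  rewrite -[in X in _ --> X](mulr1 c) -[in X in _ --> X](subr0 1).
  by apply: cvgMr; apply: cvgB; [apply: cvg_cst | apply: cvg_expr].
have gE : gain pi s = g.
  apply: (cvg_lim (@norm_hausdorff _ R)).
  have h : (fun T : nat => g + (c * (1 - l ^+ T)) * T%:R^-1) @ \oo --> g + c * 0.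
    apply: cvgD; first exact: cvg_cst.
    apply: cvgM => //; apply/gtr0_cvgV0; last exact: cvgr_idn.
    by near=> n; rewrite ltr0n; near: n; exists 1%N.
  rewrite mulr0 addr0 in h; apply: cvg_trans h; apply: near_eq_cvg.
  near=> n; have n0 : n%:R != 0 :> R by rewrite pnatr_eq0 -lt0n; near: n; exists 1%N.
  by rewrite hv mulrDl [_ * g]mulrC mulfK.
split=> //; apply: (cvg_lim (@norm_hausdorff _ R)); apply: cesaro.
apply: cvg_trans cc; apply: near_eq_cvg; near=> n.
by rewrite hv gE addrAC subrr add0r.
Unshelve. all: by end_near. Qed.

Section HardGain.
Context (R : realType) (k n : nat) (p : R) (q : 'I_k.+1 -> 'I_n -> R).
Hypotheses (p01 : 0 <= p <= 1) (q01 : forall j a, 0 <= q j a <= 1).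
Hypothesis p_gt0 : 0 < p.
Notation M := (hard_mdp p01 q01).

(** This policy never leaves its component, on which it is a two-state chain. *)
Definition commit (a : 'I_n) : policy M :=
  fun s => dirac_fdist R (if s.2 then Some a else None).

(** Rates [p] up and [q j a] down give the second eigenvalue [1 - (p + q j a)], of modulus below 1.
    The bias has mean 0 under the stationary law of the component. *)
Lemma commit_gain_bias (a : 'I_n) (j : 'I_k.+1) (b : bool) : p + q j a < 2 ->
  gain (commit a) (j, b) = p / (p + q j a) /\
  bias (commit a) (j, b) = (if b then q j a else - p) / (p + q j a) ^+ 2.
Proof.
move=> D2; have /andP[q0 _] := q01 j a.
have D0 : 0 < p + q j a by rewrite ltr_wpDr.
have Dn0 : p + q j a != 0 by rewrite gt_eqF.
apply: (@gain_bias_of_value _ _ _ _ _ _ (1 - (p + q j a))).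
  by rewrite ltr_norml; apply/andP; split; lra.
move=> T; rewrite (@hard_value _ _ _ _ _ p01 q01 a j (p / (p + q j a))
  (q j a / (p + q j a) ^+ 2) (- p / (p + q j a) ^+ 2) (1 - (p + q j a))).
- by case: b.
all: by field.
Qed.

(** The supersolution is [h] on rewarding states and 0 on idle ones. The hypothesis is what the
    actions [Some a] at rewarding states require; climbing, navigation and reset satisfy their
    inequalities. *)
Lemma hard_gain_le (pi : policy M) (h : R) : 0 <= h ->
  (forall j, \sum_a pi (j, true) (Some a) * (1 - q j a * h) <= p * h) ->
  forall s, gain pi s <= p * h.
Proof.
move=> h0 hq s.
have ph0 : 0 <= p * h by rewrite mulr_ge0 // ltW.
apply: (@gain_upper _ M pi (p * h) (fun s : state M => if s.2 then h else 0)) => //.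
have avg : #|{: 'I_k.+1 * bool}|%:R^-1 *
    (\sum_(s' : state M) if s'.2 then h else 0) <= h.
  have N0 : 0 < #|{: 'I_k.+1 * bool}|%:R :> R by rewrite ltr0n hard_state_gt0.
  rewrite ler_pdivrMl // mulr_natl -sumr_const; apply: ler_sum => -[j' b'] _ /=.
  by case: b'.
have qle (t : state M) (a : action M) : reward t a + \sum_s' trans t a s' * (if s'.2 then h else 0) <=
    if t.2 then h + (if a is Some c then 1 - q t.1 c * h else 0) else p * h.
  move: t a => [j []] [a|]; rewrite hardE /= /reward /= /hard_reward /=; try lra.
  have : p * (#|{: 'I_k.+1 * bool}|%:R^-1 *
      (\sum_(s' : state M) if s'.2 then h else 0)) <= p * h.
    by rewrite ler_wpM2l // ltW.
  lra.
move=> t; apply: le_trans (fdist_sum_le _ (qle t)) _.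
case: t => j [] /=; last by rewrite fdist_sum_cst addr0.
by rewrite fdist_sumDcst addrC lerD2r big_option mulr0 add0r.
Qed.

End HardGain.

Section NullMDP.
Context (R : realType) (k n : nat) (p : R) (p01 : 0 <= p <= 1).
Hypothesis (p_gt0 : 0 < p) (p_le : p <= 2^-1).

Definition null_mdp : mdp R := @hard_mdp R k n p (fun _ _ => p) p01 (fun _ _ => p01).

Let pn0 : p != 0. Proof. by rewrite gt_eqF. Qed.

Definition null_policy (a : 'I_n) : policy null_mdp :=
  @commit R k n p (fun _ _ => p) p01 (fun _ _ => p01) a.

Lemma null_commit (a : 'I_n) (s : state null_mdp) :
  gain (null_policy a) s = 2^-1 /\
  bias (null_policy a) s = (if s.2 then 1 else -1) * (4 * p)^-1.
Proof.
case: s => j b.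
rewrite /null_policy; have [||-> ->] := @commit_gain_bias R k n p (fun _ _ => p) p01 (fun _ _ => p01) _ a j b.
- exact: p_gt0.
- have := p_le; lra.
have pp0 : p + p != 0 by rewrite gt_eqF ?addr_gt0.
by split; [field | case: b => /=; field]; rewrite ?pp0 ?pn0.
Qed.

Lemma null_gain_le (pi : policy null_mdp) s : gain pi s <= 2^-1.
Proof.
(* [(2 * p)^-1] is the bias gap between the two states of a component. *)
have e : p * (2 * p)^-1 = 2^-1 by field.
rewrite -e; apply: hard_gain_le => //.
  by rewrite invr_ge0 mulr_ge0 // ltW.
move=> j; rewrite e.
have -> : 1 - 2^-1 = 2^-1 :> R by field.
have := fdist_sum1 (pi (j, true)); rewrite big_option => h1.
have := fdist_ge0 (pi (j, true)) None.
rewrite -mulr_suml; lra.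
Qed.

Lemma null_opt_gain (a : 'I_n) s : opt_gain (M := null_mdp) s = 2^-1.
Proof.
have [g _] := null_commit a s.
by rewrite -g; apply: opt_gain_eq => pi; rewrite g null_gain_le.
Qed.

(** The bias of committing to [a] solves the optimality equation: navigation joins idle states of
    equal bias, and the mean over a uniform reset is at most the largest bias [B]. Thus the span
    bound over optimal biases is not vacuous. *)
Lemma null_optimal_bias (a : 'I_n) : exists h : state null_mdp -> R, optimal_bias h.
Proof.
pose pi := null_policy a.
exists (bias pi), pi; split=> //.
  by move=> s; rewrite (null_opt_gain a); have [] := null_commit a s.
move=> s; rewrite (null_opt_gain a).
have bE t : bias pi t = (if t.2 then 1 else -1) * (4 * p)^-1.
  by have [] := null_commit a t.
pose B := (4 * p)^-1.
have B0 : 0 < B by rewrite invr_gt0 mulr_gt0.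
have pB : p * B = 4^-1 by rewrite /B; field.
have avg : `|#|{: 'I_k.+1 * bool}|%:R^-1 * \sum_(t : state null_mdp) bias pi t| <= B.
  have N0 : 0 < #|{: 'I_k.+1 * bool}|%:R :> R by rewrite ltr0n hard_state_gt0.
  rewrite normrM gtr0_norm ?invr_gt0 // ler_pdivrMl // mulr_natl -sumr_const.
  apply: le_trans (ler_norm_sum _ _ _) _; apply: ler_sum => t _.
  by rewrite bE; case: t.2; rewrite ?mulN1r ?mul1r ?normrN gtr0_norm.
have bell c : reward s c + \sum_s' trans s c s' * bias pi s' <= 2^-1 + bias pi s.
  move: s c => [j []] [c|]; rewrite hardE !bE /= /reward /= /hard_reward /=;
    rewrite ?mul1r ?mulN1r -/B; try lra.
  have : p * (#|{: 'I_k.+1 * bool}|%:R^-1 * \sum_(t : state null_mdp) bias pi t) <= p * B.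
    by rewrite ler_wpM2l ?(ltW p_gt0) // (le_trans (ler_norm _)).
  lra.
apply/eqP; rewrite eq_le; apply/andP; split; last first.
  apply: ge_sup; first by exists (reward s None + \sum_s' trans s None s' * bias pi s'), None.
  by move=> _ [c _ <-].
apply: ub_le_sup; first by exists (2^-1 + bias pi s) => _ [c _ <-].
move: s {bell} => [j []]; [exists (Some a) | exists None] => //;
  rewrite hardE !bE /= /reward /= /hard_reward /= ?mul1r ?mulN1r -/B; lra.
Qed.

End NullMDP.

(** * Bias span of the symmetric MDP and the alternatives *)

Section NullSpan.
Context (R : realType) (k n : nat) (p : R) (p01 : 0 <= p <= 1).
Hypothesis (p_gt0 : 0 < p) (p_le : p <= 2^-1) (n_gt0 : (0 < n)%N).
Notation M := (@null_mdp R k n p p01).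

Lemma bellman_action (h : state M -> R) s a : bellman_optimality h ->
  reward s a + \sum_s' trans s a s' * h s' <= 2^-1 + h s.
Proof.
move=> hB; rewrite -(null_opt_gain p_gt0 p_le (Ordinal n_gt0) s) hB.
apply: ub_le_sup; last by exists a.
exists (\sum_a `|reward s a + \sum_s' trans s a s' * h s'|) => _ [c _ <-].
rewrite (bigD1 c) //= (le_trans (ler_norm _)) // lerDl.
by apply: sumr_ge0.
Qed.

(** The inequality for a rewarded action bounds the gap from below, that for climbing bounds it from
    above, by the same number. *)
Lemma bellman_up_down (h : state M -> R) j : bellman_optimality h ->
  h (j, true) = h (j, false) + (2 * p)^-1.
Proof.
move=> hB.
have h1 := bellman_action (j, true) (Some (Ordinal n_gt0)) hB.
have h2 := bellman_action (j, false) None hB.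
rewrite hardE /= /hard_reward /= in h1; rewrite hardE /= /hard_reward /= in h2.
have e : p * (h (j, true) - h (j, false)) = 2^-1 by lra.
by rewrite invfM -e mulrC mulKf ?gt_eqF // addrC subrK.
Qed.

(* Navigating along the base-[n] digits of [t] leads from [j] to
   [n ^ m * j + t] modulo [k.+1]. *)
Lemma bellman_nav (h : state M -> R) m t : (t < n ^ m)%N -> bellman_optimality h ->
  forall j : 'I_k.+1, h (inZp (n ^ m * j + t), false) <= h (j, false) + m%:R / 2.
Proof.
move=> tn hB; elim: m t tn => [|m IH] t tn j.
  move: tn; rewrite expn0 ltnS leqn0 => /eqP ->.
  by rewrite mul1n addn0 valZpK mul0r addr0.
have tn' : (t %/ n < n ^ m)%N by rewrite ltn_divLR // -expnSr.
pose a : 'I_n := Ordinal (ltn_pmod t n_gt0).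
(* A navigation step earns 0 against the gain 1/2, hence raises [h] by at most 1/2. *)
have h1 := bellman_action (inZp (n ^ m * j + t %/ n), false) (Some a) hB.
rewrite hardE /= /hard_reward /= in h1.
have -> : inZp (n ^ m.+1 * j + t) = @nav k n (inZp (n ^ m * j + t %/ n)) a.
  apply: val_inj => /=; rewrite -[in RHS]modnDml modnMmr modnDml mulnDr mulnA -expnS.
  by rewrite -addnA [(n * _)%N]mulnC -divn_eq.
rewrite add0r in h1; apply: (le_trans h1).
by rewrite addrC -[m.+1%:R]natr1 mulrDl mul1r addrA lerD2r; apply: IH.
Qed.

(** Idle values differ by at most [m / 2], since [m] digits lead from any component to any other;
    rewarding values lie above them by a constant. *)
Lemma bellman_span (h : state M -> R) m : (k.+1 <= n ^ m)%N ->
  bellman_optimality h -> span h <= (2 * p)^-1 + m%:R / 2.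
Proof.
move=> km hB.
have p2 : 0 <= (2 * p)^-1 by rewrite invr_ge0 mulr_ge0 // ltW.
have hF (i j : 'I_k.+1) : h (i, false) <= h (j, false) + m%:R / 2.
  (* The digits to append encode [i - n ^ m * j] modulo [k.+1]; adding [k.+1] minus the remainder
     avoids truncated subtraction. *)
  have tlt : ((i + (k.+1 - (n ^ m * j) %% k.+1)) %% k.+1 < n ^ m)%N.
    by apply: leq_trans km; rewrite ltn_mod.
  have := bellman_nav tlt hB j.
  suff -> : inZp (n ^ m * j + (i + (k.+1 - (n ^ m * j) %% k.+1)) %% k.+1) = i :> 'I_k.+1 by [].
  apply: val_inj => /=; rewrite modnDmr addnCA.
  rewrite {1}(divn_eq (n ^ m * j) k.+1) -addnA subnKC; last by rewrite ltnW // ltn_mod.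
  by rewrite addnCA modnMDl modnDr modn_small.
have hall s t : h s <= h t + ((2 * p)^-1 + m%:R / 2).
  have m0 : 0 <= m%:R / 2 :> R by rewrite divr_ge0.
  by move: s t => [i []] [j []]; rewrite ?(bellman_up_down _ hB); have := hF i j; lra.
pose s0 : state M := (ord0, true).
rewrite /span lerBlDr addrC; apply: ge_sup; first by exists (h s0), s0.
move=> _ [s _ <-]; rewrite -lerBlDr; apply: lb_le_inf; first by exists (h s0), s0.
by move=> _ [t _ <-]; rewrite lerBlDr.
Qed.

End NullSpan.

Section AlternativeMDP.
Context (R : realType) (k n : nat) (p kappa : R) (p01 : 0 <= p <= 1).
Hypothesis (kappa01 : 0 <= kappa <= 1).
Context (i : 'I_k.+1) (a : 'I_n).

Definition alt_rate (j : 'I_k.+1) (c : 'I_n) : R :=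
  if (j == i) && (c == a) then p * (1 - kappa) else p.

Lemma alt_rate01 j c : 0 <= alt_rate j c <= 1.
Proof.
rewrite /alt_rate; case: ifP => // _.
have /andP[p0 p1] := p01; have /andP[k0 k1] := kappa01.
rewrite mulr_ge0 ?subr_ge0 //= mulr_ile1 ?subr_ge0 //.
by rewrite lerBlDr lerDl.
Qed.

Definition alt_mdp : mdp R := hard_mdp p01 alt_rate01.

Hypotheses (p_gt0 : 0 < p) (p_le : p <= 2^-1).
Hypotheses (kappa_gt0 : 0 < kappa) (kappa_le : kappa <= 2^-1).

(** [(2 - kappa / 2)^-1] is the gain of a component left at rate [p * (1 - kappa / 2)], the least
    average rate when [a] has probability at most 1/2. *)
Lemma alt_gain_le (pi : policy alt_mdp) s : pi (i, true) (Some a) <= 2^-1 ->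
  gain pi s <= (2 - kappa / 2)^-1.
Proof.
move=> pile; pose g := (2 - kappa / 2)^-1.
have [pl [kl k0]] := conj p_le (conj kappa_le kappa_gt0).
have D0 : 0 < 2 - kappa / 2 by lra.
have g0 : 0 < g by rewrite invr_gt0.
have gE : g * (2 - kappa / 2) = 1 by rewrite mulVf ?gt_eqF.
have g1 : g <= 1 by rewrite invf_le1 //; lra.
have ph : p * (g / p) = g by rewrite mulrCA divff ?gt_eqF // mulr1.
rewrite -/g -ph; apply: hard_gain_le => //.
  by rewrite divr_ge0 // ltW.
move=> j; rewrite ph.
(* Against the rate [p], only the pair [(i, a)] has a surplus, [kappa * g]; half of it plus [1 - g]
   equals [g] by [gE]. *)
have rE c : 1 - alt_rate j c * (g / p) = 1 - g + ((j == i) && (c == a))%:R * (kappa * g).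
  rewrite /alt_rate; case: ifP => _; rewrite ?mul0r ?mul1r ?addr0; last by rewrite ph.
  by rewrite mulrAC ph mulrBr mulr1; ring.
under eq_bigr do rewrite rE.
have := fdist_sum1 (pi (j, true)); rewrite big_option => h1.
have h2 := fdist_ge0 (pi (j, true)) None.
under eq_bigr do rewrite mulrDr.
rewrite big_split /= -mulr_suml.
have h3 : (\sum_(c < n) pi (j, true) (Some c)) * (1 - g) <= 1 - g.
  by rewrite -[leRHS]mul1r ler_wpM2r //; lra.
have h4 : \sum_(c < n) pi (j, true) (Some c) * (((j == i) && (c == a))%:R * (kappa * g))
    <= 2^-1 * (kappa * g).
  have [ji|ji] := eqVneq j i; last first.
    rewrite big1 ?mulr_ge0 ?(ltW g0) ?(ltW kappa_gt0) //.
    by move=> c _; rewrite /= mul0r mulr0.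
  rewrite (bigD1 a) //= eqxx mul1r big1 ?addr0 => [|c /negbTE ->]; last by rewrite mul0r mulr0.
  by rewrite ji ler_wpM2r ?mulr_ge0 // ltW.
lra.
Qed.

(** Committing to [a] has gain [(2 - kappa)^-1], at least [kappa / 8] above the bound for policies
    that give [a] probability at most 1/2. *)
Lemma alt_eps_optimal (eps : R) (pi : policy alt_mdp) : eps < kappa / 8 ->
  eps_optimal eps pi -> 2^-1 < pi (i, true) (Some a).
Proof.
move=> he opt; rewrite ltNge; apply/negP => pile.
have [pl kl k0 pp] := And4 p_le kappa_le kappa_gt0 p_gt0.
have rate : alt_rate i a = p * (1 - kappa) by rewrite /alt_rate !eqxx.
have := opt (i, true); have := alt_gain_le (i, true) pile.
have gE : gain (@commit R k n p alt_rate p01 alt_rate01 a) (i, true) = (2 - kappa)^-1.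
  have [||-> _] := @commit_gain_bias R k n p alt_rate p01 alt_rate01 _ a i true => //.
    by rewrite rate; nra.
  have k2 : 2 - kappa != 0 by rewrite gt_eqF //; lra.
  rewrite rate -{1}[p]mulr1 -[p in p + _]mulr1 -mulrDr invfM mulrACA divff ?gt_eqF // mul1r.
  by rewrite mul1r addrA.
have := @gain_le_opt R alt_mdp (@commit R k n p alt_rate p01 alt_rate01 a) (i, true).
rewrite gE => h1 h2 h3.
have : (2 - kappa)^-1 - (2 - kappa / 2)^-1 <= eps by lra.
apply/negP; rewrite -ltNge; apply: (lt_le_trans he).
have e : (2 - kappa)^-1 - (2 - kappa / 2)^-1
    = (kappa / 2) * ((2 - kappa)^-1 * (2 - kappa / 2)^-1).
  by field; rewrite ?gt_eqF //; lra.
rewrite e -mulrA ler_wpM2l ?(ltW k0) //.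
have b1 : 2^-1 <= (2 - kappa)^-1 by rewrite lef_pV2 ?posrE; lra.
have b2 : 2^-1 <= (2 - kappa / 2)^-1 by rewrite lef_pV2 ?posrE; lra.
nra.
Qed.

End AlternativeMDP.

(** * Measurability of the success event *)

Section Measurability.
Context (R : realType) (d : measure_display) (T : measurableType d).

(* Convergence is the equality of the upper and lower limits. *)
Lemma measurable_limn (u : nat -> T -> R) :
  (forall n, measurable_fun [set: T] (u n)) ->
  measurable_fun [set: T] (fun w => limn (fun n => u n w)).
Proof.
move=> mu.
pose U w := limn_esup (fun n => (u n w)%:E).
pose L w := limn_einf (fun n => (u n w)%:E).
have mE n : measurable_fun [set: T] (fun w => (u n w)%:E) by apply/measurable_EFinP.
have mU : measurable_fun [set: T] U by apply: measurable_fun_limn_esup.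
have mL : measurable_fun [set: T] L.
  apply: (@measurableT_comp _ _ _ _ _ _ oppe) => //.
  by apply: measurable_fun_limn_esup => n; apply: (@measurableT_comp _ _ _ _ _ _ oppe).
(* Off convergence [limn] is 0; the second test excludes a common infinite limit. *)
have -> : (fun w => limn (fun n => u n w)) =
    (fun w => if (U w == L w) && (U w == (fine (U w))%:E) then fine (U w) else 0).
  apply/funext => w; have [/cvg_ex[l ul]|dv] := pselect (cvgn (fun n => u n w)).
    have : (fun n => (u n w)%:E) @ \oo --> l%:E by apply: cvg_EFin => //; apply: nearW.
    move=> /cvg_limn_einf_sup[Ll Ul].
    by rewrite /U /L Ll Ul !eqxx /=; apply/cvg_lim.
  rewrite (dvgP dv); case: ifP => // /andP[/eqP UL /eqP Uf]; case: dv.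
  apply/cvg_ex; exists (fine (U w)).
  have cE : (fun n => (u n w)%:E) @ \oo --> (fine (U w))%:E.
    apply: (@squeeze_cvge _ _ _ _ (einfs (fun n => (u n w)%:E)) _ (esups (fun n => (u n w)%:E))).
    - apply: nearW => n; apply/andP; split.
        by apply: ereal_inf_lbound; exists n => /=.
      by apply: ereal_sup_ubound; exists n => /=.
    - rewrite -Uf UL /L limn_einf_lim; exact: is_cvg_einfs.
    - rewrite -Uf /U limn_esup_lim; exact: is_cvg_esups.
  by move/fine_cvgP: cE => [].
have mfU : measurable_fun [set: T] (fun w => fine (U w)).
  by apply: (@measurableT_comp _ _ _ _ _ _ fine) => //; apply: fine_measurable.
apply: measurable_fun_ifT => //.
apply: measurable_and; first exact: measurable_fun_eqe.
by apply: measurable_fun_eqe => //; apply/measurable_EFinP.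
Qed.

Lemma measurable_gt (f : T -> R) (c : R) :
  measurable_fun [set: T] f -> measurable [set w | c < f w].
Proof.
move=> mf; rewrite (_ : [set w | _] = [set: T] `&` f @^-1` `]c, +oo[%classic).
  exact: mf.
by rewrite setTI; apply/seteqP; split=> w /=; rewrite in_itv /= andbT.
Qed.

Context (M : mdp R) (out : T -> policy M).
Hypothesis m_out : forall s a, measurable_fun [set: T] (fun w => out w s a).

Lemma measurable_value n s : measurable_fun [set: T] (fun w => value (out w) n s).
Proof.
elim: n s => [|n IH] s.
  rewrite (_ : (fun _ => _) = cst 0); first exact: measurable_cst.
  by apply/funext => w; rewrite value0.
rewrite (_ : (fun _ => _) = (fun w => \sum_a out w s a *
    (reward s a + \sum_s' trans s a s' * value (out w) n s'))); last first.
  by apply/funext => w; rewrite valueS.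
apply: measurable_sum => a; apply: measurable_funM => //.
apply: measurable_funD; first exact: measurable_cst.
by apply: measurable_sum => t; apply: measurable_funM => //; apply: measurable_cst.
Qed.

(** Values are polynomials in the action probabilities and the gain is a [limn] of their averages.
    Monotonicity of the seed law is later applied to this event. *)
Lemma measurable_eps_optimal eps : measurable [set w | eps_optimal eps (out w)].
Proof.
rewrite (_ : [set w | _] = \bigcap_(s in [set: state M])
    [set w | opt_gain s - eps <= gain (out w) s]); last first.
  by apply/seteqP; split=> [w h s _|w h s]; apply: h.
apply: fin_bigcap_measurable => [|s _]; first exact: finite_finset.
rewrite (_ : [set w | _] =
  [set: T] `&` (fun w => gain (out w) s) @^-1` `[opt_gain s - eps, +oo[%classic); last first.
  by rewrite setTI; apply/seteqP; split=> w /=; rewrite in_itv /= andbT.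
apply: (measurable_limn (u := fun n w => value (out w) n s / n%:R)) => //.
  by move=> n; apply: measurable_funM => //; exact: measurable_value.
Qed.

End Measurability.

(** * Interrupted runs and change of measure *)

Section Run.
Context (R : realType) (M : mdp R) (alg : sampler M).
Notation query := (state M * action M * state M)%type.
Implicit Types (f : history M -> R) (h : history M).

Lemma reach_prob_ge0 h : 0 <= reach_prob alg h.
Proof. by elim: h => [|[[s a] s'] h IH] //=; rewrite !mulr_ge0 ?fdist_ge0. Qed.

Lemma stop_prob_ge0 h : 0 <= stop_prob alg h.
Proof. by rewrite mulr_ge0 ?reach_prob_ge0 ?fdist_ge0. Qed.

(* Expectation of [f] at the history of the run interrupted after [T] samples. *)
Definition run_mean (T : nat) f : R :=
  \sum_(0 <= n < T) \sum_(h : n.-tuple query) stop_prob alg h * f h +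
  \sum_(h : T.-tuple query) reach_prob alg h * f h.

Lemma run_mean0 f : run_mean 0 f = f [::].
Proof.
rewrite /run_mean big_geq // add0r.
by rewrite (big_tuple0 (fun h => reach_prob alg h * f h)) mul1r.
Qed.

(** Only runs that reach [T] samples change: a stopping decision keeps [f h], a query replaces it by
    its mean after one more sample. *)
Lemma run_meanS T f : run_mean T.+1 f = run_mean T f +
  \sum_(h : T.-tuple query) reach_prob alg h * \sum_(x : state M * action M)
    decide alg h (Some x) * (\sum_s' trans x.1 x.2 s' * f ((x, s') :: h) - f h).
Proof.
rewrite /run_mean big_nat_recr //= -!addrA; congr (_ + _).
rewrite (big_tupleS _ (fun h => reach_prob alg h * f h)) exchange_big -!big_split /=.
apply: eq_bigr => h _.
have -> : \sum_(x : query) reach_prob alg (x :: h) * f (x :: h) =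
    reach_prob alg h * \sum_(x : state M * action M)
      decide alg h (Some x) * \sum_s' trans x.1 x.2 s' * f ((x, s') :: h).
  rewrite mulr_sumr.
  under [in RHS]eq_bigr do rewrite mulrA mulr_sumr.
  rewrite pair_bigA; apply: eq_bigr => -[[s a] s'] _ /=.
  by rewrite !mulrA.
rewrite /stop_prob -mulrA -!mulrDr; congr (_ * _).
under [in RHS]eq_bigr do rewrite mulrBr.
rewrite sumrB -mulr_suml.
have := fdist_sum1 (decide alg h); rewrite big_option => h1.
have -> : \sum_(x : state M * action M) decide alg h (Some x) = 1 - decide alg h None.
  by rewrite -h1 addrAC subrr add0r.
ring.
Qed.

(** Optional stopping for a supermartingale, at a time bounded by [T]. *)
Lemma run_mean_drift T f :
  (forall h s a, \sum_s' trans s a s' * f ((s, a, s') :: h) <= f h) ->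
  run_mean T f <= f [::].
Proof.
move=> hf; elim: T => [|T IH]; first by rewrite run_mean0.
rewrite run_meanS; apply: le_trans IH; rewrite gerDl.
rewrite -oppr_ge0 -sumrN; apply: sumr_ge0 => h _.
rewrite -mulrN mulr_ge0 ?reach_prob_ge0 // -sumrN; apply: sumr_ge0 => -[s a] _ /=.
by rewrite -mulrN mulr_ge0 ?fdist_ge0 // opprB subr_ge0.
Qed.

Lemma run_mean1 T : run_mean T (fun=> 1) = 1.
Proof.
elim: T => [|T IH]; first by rewrite run_mean0.
rewrite run_meanS IH big1 ?addr0 // => h _; rewrite big1 ?mulr0 // => -[s a] _ /=.
by rewrite fdist_sum_cst subrr mulr0.
Qed.

Lemma run_mean_le T f g : (forall h, f h <= g h) -> run_mean T f <= run_mean T g.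
Proof.
move=> fg; apply: lerD; last first.
  by apply: ler_sum => h _; rewrite ler_wpM2l ?reach_prob_ge0.
by apply: ler_sum => n _; apply: ler_sum => h _; rewrite ler_wpM2l ?stop_prob_ge0.
Qed.

Lemma run_meanZ T (c : R) f : run_mean T (fun h => c * f h) = c * run_mean T f.
Proof.
rewrite /run_mean mulrDr !mulr_sumr; congr (_ + _); apply: eq_bigr => h _; last first.
  by rewrite mulrCA.
by rewrite mulr_sumr; apply: eq_bigr => h' _; rewrite mulrCA.
Qed.

Lemma run_meanD T f g :
  run_mean T (fun h => f h + g h) = run_mean T f + run_mean T g.
Proof.
rewrite /run_mean addrACA -!big_split /=; congr (_ + _); apply: eq_bigr => h _; last first.
  by rewrite mulrDr.
by rewrite -big_split /=; apply: eq_bigr => h' _; rewrite mulrDr.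
Qed.

Lemma run_mean_sum T (I : finType) (f : I -> history M -> R) :
  run_mean T (fun h => \sum_i f i h) = \sum_i run_mean T (f i).
Proof.
rewrite /run_mean big_split /= [X in _ = X + _]exchange_big /= [X in _ = _ + X]exchange_big /=.
congr (_ + _); apply: eq_bigr => h _; last by rewrite mulr_sumr.
by rewrite exchange_big /=; apply: eq_bigr => h' _; rewrite mulr_sumr.
Qed.

Lemma nb_samples_pmf_ge0 n : 0 <= nb_samples_pmf alg n.
Proof. by apply: sumr_ge0 => h _; apply: stop_prob_ge0. Qed.

Lemma reach_total T :
  \sum_(h : T.-tuple query) reach_prob alg h = 1 - psum (nb_samples_pmf alg) T.
Proof.
rewrite -(run_mean1 T) /run_mean /psum /nb_samples_pmf.
under [X in _ = X + _ - _]eq_bigr do under eq_bigr do rewrite mulr1.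
under [X in _ = _ + X - _]eq_bigr do rewrite mulr1.
by rewrite addrAC subrr add0r.
Qed.

Lemma nb_samples_psum_le1 T : psum (nb_samples_pmf alg) T <= 1.
Proof.
rewrite -subr_ge0 -reach_total; apply: sumr_ge0 => h _; exact: reach_prob_ge0.
Qed.

(** Interruption at [T] turns the number of samples into its minimum with [T]. *)
Lemma tmean_nb_samples T :
  tmean (nb_samples_pmf alg) T = run_mean T (fun h => (size h)%:R).
Proof.
rewrite /tmean /run_mean -reach_total; congr (_ + _).
  apply: eq_bigr => n _; rewrite mulr_sumr; apply: eq_bigr => h _.
  by rewrite size_tuple mulrC.
by rewrite mulr_sumr; apply: eq_bigr => h _; rewrite size_tuple mulrC.
Qed.

(** Here [phi h] bounds the chance of success after stopping at [h]. The stopping mass is at most 1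
    in total, so stopped failures get at most what success leaves. *)
Lemma failure_le (eps delta : R) (phi : history M -> R) :
  (forall h, 0 <= phi h <= 1) ->
  (forall h, (seed_law alg [set w | eps_optimal (M := M) eps (output alg h w)] <= (phi h)%:E)%E) ->
  ((1 - delta)%:E <= success_prob alg eps)%E ->
  forall T, \sum_(0 <= n < T) \sum_(h : n.-tuple query) stop_prob alg h * (1 - phi h)
    <= delta.
Proof.
move=> phi01 hphi hs T; set W := \sum_(0 <= n < T) _.
pose u n := \sum_(h : n.-tuple query) stop_prob alg h * phi h.
pose v n := \sum_(h : n.-tuple query) stop_prob alg h * (1 - phi h).
have u0 n : 0 <= u n.
  apply: sumr_ge0 => h _; rewrite mulr_ge0 ?stop_prob_ge0 //.
  by have /andP[] := phi01 h.
have v0 n : 0 <= v n.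
  apply: sumr_ge0 => h _; rewrite mulr_ge0 ?stop_prob_ge0 // subr_ge0.
  by have /andP[] := phi01 h.
have uv n : u n + v n = nb_samples_pmf alg n.
  rewrite -big_split /=; apply: eq_bigr => h _.
  by rewrite -mulrDr addrC subrK mulr1.
suff : (success_prob alg eps <= (1 - W)%:E)%E.
  by move=> /(le_trans hs); rewrite lee_fin; lra.
apply: (@le_trans _ _ (\sum_(0 <= n <oo) (u n)%:E)%E).
  apply: lee_nneseries => n _.
    move=> _; apply: sume_ge0 => h _; apply: mule_ge0 => //.
    by rewrite lee_fin stop_prob_ge0.
  rewrite /u -sumEFin; apply: lee_sum => h _; rewrite [leRHS]EFinM.
  by apply: lee_wpmul2l; rewrite ?lee_fin ?stop_prob_ge0.
apply: series_le => // N; rewrite lee_fin lerBrDr.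
have WT : W = psum v T by [].
pose L := maxn N T.
have h1 : psum u N <= psum u L by rewrite psum_mono // leq_maxl.
have h2 : psum v T <= psum v L by rewrite psum_mono // leq_maxr.
have h3 : psum u L + psum v L <= 1.
  rewrite /psum -big_split /=; under eq_bigr do rewrite uv.
  exact: nb_samples_psum_le1.
by rewrite WT; lra.
Qed.

End Run.

Section ChangeOfMeasure.
Context (R : realType) (F : mdp_frame R) (alg : sampler F).
Context (t0 t1 : state F -> action F -> fdist R (state F)).
Context (lam : state F -> action F -> state F -> R).
Hypothesis t1E : forall s a s', t1 s a s' = t0 s a s' * expR (lam s a s').
Notation M0 := (MDP t0).
Notation M1 := (MDP t1).
Notation query := (state F * action F * state F)%type.

(** Log-likelihood ratio of [t1] against [t0]: decisions have the same law under both, so only the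
    samples contribute. *)
Definition llr (h : history F) : R := \sum_(x <- h) lam x.1.1 x.1.2 x.2.

Lemma reach_prob_change (h : history F) :
  reach_prob (M := M1) alg h = reach_prob (M := M0) alg h * expR (llr h).
Proof.
elim: h => [|[[s a] s'] h IH]; first by rewrite /llr big_nil expR0 mulr1.
rewrite /= IH t1E /llr big_cons expRD /=; ring.
Qed.

Context (x0 : state F * action F) (D : R).
Hypothesis div_le : forall s a,
  - (\sum_s' t0 s a s' * lam s a s') <= D * ((s, a) == x0)%:R.

Definition nb_queries (h : history F) : R := (count (fun x => x.1 == x0) h)%:R.

(** Under [M0], [- llr] minus [D] times the number of queries of [x0] is a supermartingale: the mean
    increment of [- llr] is the Kullback-Leibler divergence of the queried pair. *)
Lemma divergence_le T : - run_mean (M := M0) alg T llr <= D * run_mean (M := M0) alg T nb_queries.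
Proof.
have : run_mean (M := M0) alg T (fun h => -1 * llr h + - D * nb_queries h) <= 0.
  apply: le_trans (run_mean_drift _ _ _) _ => [h s a|]; last first.
    by rewrite /llr /nb_queries big_nil !mulr0 addr0.
  have -> : \sum_s' t0 s a s' * (-1 * llr ((s, a, s') :: h) + - D * nb_queries ((s, a, s') :: h))
     = -1 * llr h + - D * nb_queries h - D * ((s, a) == x0)%:R - \sum_s' t0 s a s' * lam s a s'.
    rewrite -sumrN; under [X in _ = _ + X]eq_bigr do rewrite -mulrN.
    rewrite -(fdist_sumDcst (t0 s a)); apply: eq_bigr => s' _; congr (_ * _).
    rewrite /llr /nb_queries big_cons /= natrD; ring.
  by have := div_le s a; lra.
by rewrite run_meanD !run_meanZ; lra.
Qed.

(* The tangent of [ln] at [delta] is used on the failure event, and at 1 on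
   its complement. *)
Lemma failure_information T (delta : R) (phi : history F -> R) : 0 < delta ->
  (forall h, 0 <= phi h <= 1) ->
  \sum_(0 <= n < T) \sum_(h : n.-tuple query) stop_prob (M := M1) alg h * (1 - phi h) <= delta ->
  ln delta^-1 * (\sum_(0 <= n < T) \sum_(h : n.-tuple query)
    stop_prob (M := M0) alg h * (1 - phi h)) - 2 <= D * run_mean (M := M0) alg T nb_queries.
Proof.
move=> d0 phi01 W1.
apply: le_trans (divergence_le T).
have tangent1 h : - expR (llr h) <= - llr h by have := expR_ge1Dx (llr h); lra.
have tangentd h : ln delta^-1 - delta^-1 * expR (llr h) <= - llr h.
  have dV : 0 < delta^-1 by rewrite invr_gt0.
  have := expR_ge1Dx (ln delta^-1 + llr h).
  by rewrite expRD lnK ?posrE //; lra.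
(* The two tangents are combined with weights [1 - phi h] and [phi h]; the second term is weakened
   to weight 1, so that together with the interrupted runs it sums to the total mass under [M1]. *)
have key : (\sum_(0 <= n < T) \sum_(h : n.-tuple query)
     stop_prob (M := M0) alg h * ((1 - phi h) * (ln delta^-1 - delta^-1 * expR (llr h)) - expR (llr h)))
   - (\sum_(h : T.-tuple query) reach_prob (M := M0) alg h * expR (llr h))
   <= - run_mean (M := M0) alg T llr.
  rewrite /run_mean opprD -!sumrN; apply: lerD; last first.
    apply: ler_sum => h _; rewrite -!mulrN ler_wpM2l //.
    exact: (@reach_prob_ge0 _ M0).
  apply: ler_sum => n _; rewrite -sumrN; apply: ler_sum => h _.
  rewrite -[leRHS]mulrN; apply: ler_wpM2l; first exact: (@stop_prob_ge0 _ M0).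
  have /andP[p0 p1] := phi01 h.
  have := tangent1 h; have := tangentd h; have := expR_gt0 (llr h).
  nra.
apply: le_trans key.
have stop_change h : stop_prob (M := M1) alg h = stop_prob (M := M0) alg h * expR (llr h).
  by rewrite /stop_prob reach_prob_change mulrAC.
have one := run_mean1 (M := M1) alg T.
rewrite /run_mean in one.
have e1 : \sum_(0 <= n < T) \sum_(h : n.-tuple query)
     stop_prob (M := M0) alg h * ((1 - phi h) * (ln delta^-1 - delta^-1 * expR (llr h)) - expR (llr h))
  = ln delta^-1 * (\sum_(0 <= n < T) \sum_(h : n.-tuple query) stop_prob (M := M0) alg h * (1 - phi h))
    - delta^-1 * (\sum_(0 <= n < T) \sum_(h : n.-tuple query) stop_prob (M := M1) alg h * (1 - phi h))
    - \sum_(0 <= n < T) \sum_(h : n.-tuple query) stop_prob (M := M1) alg h * 1.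
  rewrite !mulr_sumr -!sumrB; apply: eq_bigr => n _.
  rewrite !mulr_sumr -!sumrB; apply: eq_bigr => h _.
  by rewrite stop_change; ring.
have e2 : \sum_(h : T.-tuple query) reach_prob (M := M0) alg h * expR (llr h) =
    \sum_(h : T.-tuple query) reach_prob (M := M1) alg h * 1.
  by apply: eq_bigr => h _; rewrite reach_prob_change mulr1.
rewrite e1 e2.
(* The loss of 2 is this term plus the total mass 1 under [M1]. *)
have : delta^-1 * (\sum_(0 <= n < T) \sum_(h : n.-tuple query) stop_prob (M := M1) alg h * (1 - phi h)) <= 1.
  by rewrite ler_pdivrMl // mulr1.
by move: one => /=; lra.
Qed.

End ChangeOfMeasure.

(** * The lower bound *)

Lemma sum_eq_inj_le1 (R : numDomainType) (I : finType) (T : eqType) (e : I -> T) (y : T) :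
  injective e -> \sum_i (y == e i)%:R <= 1 :> R.
Proof.
move=> e_inj; case: (pickP (fun i => y == e i)) => [i /eqP ->|none].
  rewrite (bigD1 i) //= eqxx big1 ?addr0 // => j ji.
  by rewrite (inj_eq e_inj) eq_sym (negbTE ji).
by rewrite big1 ?ler01 // => i _; rewrite none.
Qed.

Section LowerBound.
Context (R : realType) (k n : nat) (p kappa : R).
Context (p01 : 0 <= p <= 1) (kappa01 : 0 <= kappa <= 1).
Hypotheses (p_gt0 : 0 < p) (p_le : p <= 2^-1).
Hypotheses (kappa_gt0 : 0 < kappa) (kappa_le : kappa <= 2^-1).
Notation F := (hard_frame R k n).
Notation null := (@null_mdp R k n p p01).
Notation alt := (alt_mdp p01 kappa01).

(** The test on [s'.2] separates staying from decaying; next states outside component [i] have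
    probability 0 under both kernels. *)
Definition log_ratio (i : 'I_k.+1) (a : 'I_n) (s : state F) (b : action F) (s' : state F) : R :=
  if (s, b) == ((i, true), Some a) then
    if s'.2 then ln ((1 - p * (1 - kappa)) / (1 - p)) else ln (1 - kappa)
  else 0.

Lemma alt_trans i a (s : state F) (b : action F) (s' : state F) :
  trans (m := alt i a) s b s' = trans (m := null) s b s' * expR (log_ratio i a s b s').
Proof.
have [pl [p0 [kl k0]]] := conj p_le (conj p_gt0 (conj kappa_le kappa_gt0)).
have rate_pos : 0 < (1 - p * (1 - kappa)) / (1 - p).
  by rewrite divr_gt0 //; nra.
rewrite /log_ratio; move: s b s' => [j []] [c|] s';
  rewrite !xpair_eqE /= ?andbF ?expR0 ?mulr1 //.
rewrite /alt_rate andbT (inj_eq Some_inj) /=.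
case: ifP => _; last by rewrite expR0 mulr1.
case: s' => j' [] /=; rewrite !xpair_eqE /= ?andbF ?mulr0 ?addr0 ?add0r.
  rewrite lnK ?posrE // [RHS]mulrAC; congr (_ * _).
  by rewrite mulrCA divff ?mulr1 // gt_eqF //; lra.
rewrite lnK ?posrE; last by lra.
by rewrite mulrAC.
Qed.

(** The bound [- ln x <= x^-1 - 1] replaces the divergence by a chi-square divergence, equal to
    [p * kappa ^+ 2] times two inverse factors of at most 2. Its factor [p] is the source of [H] in
    the lower bound. *)
Lemma alt_divergence i a (s : state F) (b : action F) :
  - (\sum_s' trans (m := null) s b s' * log_ratio i a s b s')
    <= 4 * p * kappa ^+ 2 * ((s, b) == ((i, true), Some a))%:R.
Proof.
have [pl [p0 [kl k0]]] := conj p_le (conj p_gt0 (conj kappa_le kappa_gt0)).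
rewrite /log_ratio; case: eqP => [[-> ->]|_]; last first.
  by rewrite big1 ?oppr0 ?mulr0 // => s' _; rewrite mulr0.
rewrite hardE /= mulr1.
have ln_lower (x : R) : 0 < x -> - ln x <= x^-1 - 1.
  move=> x0; rewrite -lnV ?posrE //.
  have := @le_ln1Dx R (x^-1 - 1); rewrite [1 + _]addrC subrK; apply.
  by have := invr_gt0 x; rewrite x0; lra.
have k1 : 0 < 1 - kappa by lra.
have q1 : 0 < 1 - p by lra.
have r1 : 0 < 1 - p * (1 - kappa) by nra.
have l1 := ln_lower _ k1.
have l2 := ln_lower _ (divr_gt0 r1 q1).
apply: (@le_trans _ _ (p * ((1 - kappa)^-1 - 1)
    + (1 - p) * (((1 - p * (1 - kappa)) / (1 - p))^-1 - 1))).
  by rewrite opprD; apply: lerD; rewrite -[leLHS]mulrN ler_wpM2l // ltW.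
have -> : p * ((1 - kappa)^-1 - 1) + (1 - p) * (((1 - p * (1 - kappa)) / (1 - p))^-1 - 1)
    = p * kappa ^+ 2 * ((1 - kappa)^-1 * (1 - p * (1 - kappa))^-1).
  by field; rewrite !gt_eqF.
rewrite (_ : 4 * p * kappa ^+ 2 = p * kappa ^+ 2 * 4); last by ring.
apply: ler_wpM2l; first by rewrite mulr_ge0 ?sqr_ge0 ?ltW.
have b1 : (1 - kappa)^-1 <= 2 by rewrite -[2]invrK lef_pV2 ?posrE ?invr_gt0 //; lra.
have b2 : (1 - p * (1 - kappa))^-1 <= 2 by rewrite -[2]invrK lef_pV2 ?posrE ?invr_gt0 //; nra.
have : 0 <= (1 - kappa)^-1 by rewrite invr_ge0 ltW.
have : 0 <= (1 - p * (1 - kappa))^-1 by rewrite invr_ge0 ltW.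
nra.
Qed.

Context (alg : sampler F).

Definition majority (h : history F) (i : 'I_k.+1) (a : 'I_n) : set (seed_space alg) :=
  [set w | 2^-1 < output alg h w (i, true) (Some a)].

Definition majority_prob (i : 'I_k.+1) (a : 'I_n) (h : history F) : R :=
  fine (seed_law alg (majority h i a)).

Lemma measurable_majority h i a : measurable (majority h i a).
Proof. by apply: measurable_gt; exact: measurable_output. Qed.

Lemma seed_law_majority h i a : seed_law alg (majority h i a) = (majority_prob i a h)%:E.
Proof.
by rewrite fineK // fin_num_measure //; exact: measurable_majority.
Qed.

Lemma majority_prob01 i a h : 0 <= majority_prob i a h <= 1.
Proof.
rewrite -!lee_fin -seed_law_majority measure_ge0 probability_le1 //.
exact: measurable_majority.
Qed.

(** The strict threshold 1/2 makes the majority events of distinct actions disjoint. *)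
Lemma sum_majority_prob_le1 i h : \sum_a majority_prob i a h <= 1.
Proof.
rewrite -lee_fin -sumEFin.
under eq_bigr do rewrite -seed_law_majority.
rewrite fsbig_seq ?index_enum_uniq // -measure_fin_bigcup //=; last first.
- by move=> a _; exact: measurable_majority.
- apply/trivIsetP => a b _ _ ab; apply/seteqP; split=> // w [].
  rewrite /majority /= => wa wb.
  have := fdist_sum1 (output alg h w (i, true)); rewrite big_option.
  rewrite (bigD1 a) //= (bigD1 b) /=; last by rewrite eq_sym.
  have := fdist_ge0 (output alg h w (i, true)) None.
  have : 0 <= \sum_(c | (c != a) && (c != b)) output alg h w (i, true) (Some c).
    by apply: sumr_ge0 => c _; exact: fdist_ge0.
  by lra.
apply: probability_le1; apply: fin_bigcup_measurable => // a _.
exact: measurable_majority.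
Qed.

Lemma sum_nb_queries_le h :
  \sum_(x : 'I_k.+1 * 'I_n) nb_queries (F := F) ((x.1, true), Some x.2) h <= (size h)%:R.
Proof.
rewrite /nb_queries; elim: h => [|y h IH]; first by rewrite big1.
under eq_bigr do rewrite /= natrD.
rewrite big_split [size _]/= -[(size h).+1]add1n natrD; apply: lerD => //.
apply: (sum_eq_inj_le1 _ (e := fun x : 'I_k.+1 * 'I_n => ((x.1, true), Some x.2))).
by move=> [i a] [j b] [-> ->].
Qed.

Context (eps delta : R).
Hypotheses (eps_lt : eps < kappa / 8) (delta_gt0 : 0 < delta).
Hypothesis correct : forall i a, ((1 - delta)%:E <= success_prob (M := alt i a) alg eps)%E.

(** In the alternative, success forces a majority for [a], so stopping without one has probability
    at most [delta] there; the change of measure transfers this to the symmetric MDP. *)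
Lemma query_lower T i a :
  ln delta^-1 * (\sum_(0 <= m < T) \sum_(h : m.-tuple (state F * action F * state F))
     stop_prob (M := null) alg h * (1 - majority_prob i a h)) - 2
  <= 4 * p * kappa ^+ 2 *
     run_mean (M := null) alg T (nb_queries (F := F) ((i, true), Some a)).
Proof.
apply: (@failure_information R F alg (trans (m := null)) (trans (m := alt i a))
  (log_ratio i a) (alt_trans i a) ((i, true), Some a) (4 * p * kappa ^+ 2)
  (alt_divergence i a) T delta (majority_prob i a) delta_gt0 (majority_prob01 i a)).
apply: (failure_le (M := alt i a) _ _ (correct i a)) => h; first exact: majority_prob01.
rewrite -seed_law_majority; apply: le_measure; rewrite ?inE.
- by apply: measurable_eps_optimal => s b; exact: measurable_output.
- exact: measurable_majority.
- by move=> w; exact: alt_eps_optimal.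
Qed.

(** Each stopped history misses the majority for all but one action in total, so the sum of failures
    is at least [3 / 4 * (n - 1)], hence at least [n / 2]. Since [ln delta^-1] is at least 8, the
    loss [2 * n] costs at most half of the result. *)
Lemma component_lower T i : (4 <= n)%N -> 8 <= ln delta^-1 ->
  3 / 4 <= psum (nb_samples_pmf (M := null) alg) T ->
  n%:R / 4 * ln delta^-1 <= 4 * p * kappa ^+ 2 *
    \sum_a run_mean (M := null) alg T (nb_queries (F := F) ((i, true), Some a)).
Proof.
move=> n4 l8 stopped; rewrite mulr_sumr.
apply: le_trans (ler_sum _ (fun a _ => query_lower T i a)).
rewrite sumrB -mulr_sumr sumr_const card_ord -[_ *+ n]mulr_natr.
set W := \sum_(a < n) _.
have hW : (n%:R - 1) * psum (nb_samples_pmf (M := null) alg) T <= W.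
  rewrite /W exchange_big /= mulr_sumr; apply: ler_sum => m _.
  rewrite exchange_big /= mulr_sumr; apply: ler_sum => h _.
  rewrite -mulr_sumr mulrC; apply: ler_wpM2l; first exact: (@stop_prob_ge0 _ null).
  rewrite sumrB sumr_const card_ord lerD2l lerN2; exact: sum_majority_prob_le1.
have n4' : 4 <= n%:R :> R by rewrite (ler_nat _ 4).
have : n%:R / 2 <= W by apply: le_trans hW; nra.
nra.
Qed.

Lemma null_samples_lower : (4 <= n)%N -> 8 <= ln delta^-1 ->
  ((k.+1%:R * (n%:R / 4 * ln delta^-1) / (4 * p * kappa ^+ 2))%:E
    <= expected_samples (M := null) alg)%E.
Proof.
move=> n4 l8.
have pmf0 m : 0 <= nb_samples_pmf (M := null) alg m by exact: nb_samples_pmf_ge0.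
have le1 := nb_samples_psum_le1 (M := null) alg.
have [total|Eoo] := expect_enat_dich pmf0 le1; last first.
  by rewrite /expected_samples Eoo leey.
(* If the stopping mass were not to approach 1, the mean would be infinite; otherwise some horizon
   [T] captures 3/4 of it. *)
have [//|T hT] := total 4^-1; have {}hT : 3 / 4 <= psum (nb_samples_pmf (M := null) alg) T by lra.
apply: le_trans (tmean_le_expect pmf0 le1 T).
have D0 : 0 < 4 * p * kappa ^+ 2 by rewrite !mulr_gt0 // exprn_gt0.
rewrite lee_fin ler_pdivrMr // mulrC tmean_nb_samples.
have h1 : \sum_(i < k.+1) \sum_(a < n)
    run_mean (M := null) alg T (nb_queries (F := F) ((i, true), Some a)) <=
    run_mean (M := null) alg T (fun h => (size h)%:R).
  rewrite pair_bigA /= -run_mean_sum; apply: run_mean_le => h.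
  exact: sum_nb_queries_le.
apply: (@le_trans _ _ (4 * p * kappa ^+ 2 * \sum_(i < k.+1) \sum_(a < n)
    run_mean (M := null) alg T (nb_queries (F := F) ((i, true), Some a)))); last first.
  by rewrite mulrC ler_wpM2r // ltW.
rewrite mulr_sumr mulr_natr -[X in _ *+ X](card_ord k.+1) -sumr_const.
by apply: ler_sum => i _; exact: component_lower.
Qed.

End LowerBound.

(** * Navigation depth, constants and choice of parameters *)

(** Only [A.-1] actions navigate, but [A <= A.-1 ^ 2], so doubling the depth compensates; the
    summand 1 comes from rounding up. *)
Lemma log_nav_depth (R : realType) (S A : nat) : (2 <= S)%N -> (5 <= A)%N ->
  exists2 m, (S <= A.-1 ^ m)%N & m%:R <= 2 * (ln S%:R / ln A%:R) + 1 :> R.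
Proof.
move=> S2 A5; set x : R := 2 * (ln S%:R / ln A%:R).
have lnA : 0 < ln (A%:R : R) by rewrite ln_gt0 // ltr1n; lia.
have x0 : 0 <= x by rewrite !mulr_ge0 ?invr_ge0 ?(ltW lnA) // ln_ge0 // ler1n; lia.
have /andP[xm mx] := truncn_itv x0.
exists (Num.truncn x).+1; last by rewrite -natr1 lerD2r.
set m := (Num.truncn x).+1.
have h1 : (S ^ 2 <= A ^ m)%N.
  rewrite -(ler_nat R) !natrX -ler_ln ?posrE ?exprn_gt0 ?ltr0n //; try lia.
  rewrite !lnXn ?ltr0n //; try lia.
  have : x < m%:R by [].
  rewrite {1}/x mulrA ltr_pdivrMr // => /ltW.
  by rewrite !mulr_natl.
have h2 : (A <= A.-1 ^ 2)%N by rewrite -mulnn; nia.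
have h3 : (A ^ m <= (A.-1 ^ m) ^ 2)%N by rewrite -expnM mulnC expnM leq_exp2r.
by rewrite -(leq_exp2r _ _ (ltn0Sn 1)) (leq_trans h1).
Qed.

(** The factor 6 is lost in rounding [s] and [a], and [64 ^+ 2] is [4 * 4 * 16 ^+ 2]. *)
Lemma sample_bound_arith (R : realFieldType) (s a k n H eps L : R) :
  0 <= s <= 3 * k -> 0 <= a <= 2 * n -> 0 < H -> 0 < eps -> 0 <= L ->
  (6 * 64 ^+ 2)^-1 * s * a * H * eps ^- 2 * L
    <= k * (n / 4 * L) / (4 * H^-1 * (16 * eps) ^+ 2).
Proof.
move=> /andP[s0 sk] /andP[a0 an] H0 eps0 L0.
have nz (m : nat) : m.+1%:R != 0 :> R by rewrite pnatr_eq0.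
have hsa : s * a <= (3 * k) * (2 * n) by apply: ler_pM.
pose X := (64 ^+ 2)^-1 * (H * eps ^- 2 * L).
have X0 : 0 <= X.
  apply: mulr_ge0; first by rewrite invr_ge0 exprn_ge0 // ler0n.
  by apply: mulr_ge0 => //; apply: mulr_ge0; rewrite ?invr_ge0 ?sqr_ge0 ?ltW.
have -> : k * (n / 4 * L) / (4 * H^-1 * (16 * eps) ^+ 2) = (k * n) * X.
  rewrite /X (_ : 64 = 4 * 16); last by rewrite -natrM.
  field.
  by rewrite !gt_eqF ?ltr0n.
have -> : (6 * 64 ^+ 2)^-1 * s * a * H * eps ^- 2 * L = (s * a / 6) * X.
  rewrite /X invfM; ring.
apply: ler_wpM2r => //.
rewrite ler_pdivrMr ?ltr0n //; apply: le_trans hsa _.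
by rewrite mulrACA mulrC -natrM.
Qed.

Theorem corollary5 (R : realType) :
  exists (c c1 c2 eps0 delta0 : R) (S0 A0 : nat),
    [/\ 0 < c, 0 < c1, 0 < c2, 0 < eps0 & 0 < delta0] /\
    forall (eps delta : R) (S A : nat) (H : R) (alg : algorithm R),
      0 < eps <= eps0 ->
      0 < delta <= delta0 ->
      (S0 <= S)%N -> (A0 <= A)%N ->
      Num.max (c1 * (ln S%:R / ln A%:R)) c2 <= H ->
      eps_delta_correct eps delta alg ->
      exists M : mdp R,
        [/\ communicating M,
            (#|state M| <= S)%N,
            (#|action M| <= A)%N,
            (exists h : state M -> R, optimal_bias h) /\
            (forall h : state M -> R, optimal_bias h -> span h <= H)
          & ((c * S%:R * A%:R * H * eps ^- 2 * ln (delta^-1))%:E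
               <= expected_samples (alg M))%E].
Proof.
(* [eps0] gives [kappa <= 1/2], [delta0] gives [8 <= ln delta^-1], [c2] gives [p <= 1/2], and [A0]
   leaves at least four navigation actions. With [c1 = 4] and [c2 = 2], half the navigation depth,
   at most [log_A S + 1/2], fits in [H / 2]; the bias gap takes the other half. *)
exists ((6 * 64 ^+ 2)^-1), 4, 2, (32^-1), (expR (- 8)), 2%N, 5%N.
split; first by split; rewrite ?invr_gt0 ?mulr_gt0 ?exprn_gt0 ?expR_gt0 ?ltr0n.
move=> eps delta S A H alg /andP[eps0 eps_le] /andP[delta0 delta_le] S2 A5.
rewrite ge_max => /andP[HS H2] correct.
have H0 : 0 < H by lra.
(* Two states per component and the extra action [None] fix [k] and [n]; [kappa / 8] is [2 * eps],
   above [eps]. *)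
set k := S./2.-1; set n := A.-1; set p := H^-1; set kappa := 16 * eps.
have kE : k.+1 = S./2 by rewrite /k; clear -S2; lia.
have nE : n.+1 = A by rewrite /n; clear -A5; lia.
have p0 : 0 < p by rewrite invr_gt0.
have p_le : p <= 2^-1 by rewrite lef_pV2 ?posrE.
have p01 : 0 <= p <= 1 by lra.
have kappa0 : 0 < kappa by rewrite /kappa; lra.
have kappa_le : kappa <= 2^-1 by rewrite /kappa; lra.
have kappa01 : 0 <= kappa <= 1 by lra.
have n4 : (4 <= n)%N by rewrite /n; clear -A5; lia.
have L8 : 8 <= ln delta^-1.
  by rewrite lnV ?posrE // lerNr -[leRHS]expRK ler_ln ?posrE ?expR_gt0.
exists (@null_mdp R k n p p01); split.
- exact: hard_communicating.
- by rewrite card_prod card_ord card_bool kE; clear; lia.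
- by rewrite card_option card_ord nE.
- have n0 : (0 < n)%N by clear -n4; lia.
  split; first exact: (null_optimal_bias k p01 p0 p_le (Ordinal n0)).
  move=> h [pi [_ _ hB]].
  have [m Sm mle] := log_nav_depth R S2 A5.
  have km : (k.+1 <= n ^ m)%N by apply: leq_trans Sm; rewrite kE; clear; lia.
  apply: le_trans (bellman_span p0 p_le n0 km hB) _.
  rewrite invfM invrK; lra.
have hlow := null_samples_lower (alg := alg (hard_frame R k n)) p0 p_le kappa0 kappa_le.
apply: le_trans (hlow p01 kappa01 eps delta _ delta0 _ n4 L8).
- rewrite lee_fin; apply: sample_bound_arith => //.
  + by rewrite ler0n -natrM ler_nat kE; clear -S2; lia.
  + by rewrite ler0n -natrM ler_nat /n; clear -A5; lia.
  + exact: le_trans L8.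
- rewrite /kappa; lra.
(* The witness and the alternatives share one frame, hence one sampler; correctness is invoked at
   the alternatives. *)
- move=> i a; apply: correct; exact: hard_communicating.
Qed.
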